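(* Let $k$ be a field, let $n$ be a positive integer, and let $$R=k[z,x_1,\dots,x_d]/(z^n-g)$$ be a normal hypersurface over $k$, where $g\in k[x_1,\dots,x_d]$ is a weighted homogeneous polynomial with degree relatively prime to $n$. Let $g=h_1\cdots h_r$, where $h_i\in k[x_1,\dots,x_d]$ are irreducible polynomials. Then there is an isomorphism of groups $$\operatorname{Cl}(R)\cong(\mathbb{Z}/n\mathbb{Z})^{r-1},$$ and the images in $\operatorname{Cl}(R)$ of the ideals $(z,h_1),\dots,(z,h_{r-1})$ of $R$ form a minimal generating set for $\operatorname{Cl}(R)$.
   Context: Here $A=k[x_1,\dots,x_d]$ is a polynomial ring over the field $k$, and $z$ is a further indeterminate. A polynomial $g\in A$ is called weighted homogeneous if there exists an $\mathbb{N}$-grading on $A$, with $A_0=k$, for which $g$ is a homogeneous element; the degree of $g$ is its degree in such a grading. $\operatorname{Cl}(R)$ denotes the divisor class group of the normal domain $R$, i.e. the group of Weil divisors (free abelian group on the height one primes of $R$) modulo principal divisors. The image in $\operatorname{Cl}(R)$ of a nonzero ideal $I$ of $R$ is the class of the divisor $\sum_P v_P(I)\,P$, where $P$ runs over height one primes of $R$ and $v_P(I)=\min\{v_P(f): 0\ne f\in I\}$, with $v_P$ the discrete valuation of $R_P$.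
   Formalization: Minimality of the generating set is claimed only for n ≥ 2: for n = 1 the group Cl(R) is trivial, so for r ≥ 2 the zero classes generate it but not minimally; the isomorphism and generation are stated for all n ≥ 1. *)

(* Defs.v *)
From HB Require Import structures.
From mathcomp Require Import all_boot all_order all_algebra.
From mathcomp Require Import boolp classical_sets.
From mathcomp Require Import freeg mpoly.

Set Implicit Arguments.
Unset Strict Implicit.
Unset Printing Implicit Defensive.

Import Order.TTheory GRing.Theory Num.Theory.
Local Open Scope ring_scope.
Local Open Scope quotient_scope.

Section Gradings.
Variable A : comNzRingType.

(* [G] is an N-grading of the ring [A]: every [G i] is an additive subgroup,
   [A] is the (internal) direct sum of the [G i], and G i G j <= G (i + j).  *)
Definition is_grading (G : nat -> set A) : Prop :=
  [/\ forall i, G i 0 /\ (forall a b, G i a -> G i b -> G i (a - b)),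
      forall i j a b, G i a -> G j b -> G (i + j)%N (a * b),
      forall a, exists m (f : nat -> A),
        (forall i, G i (f i)) /\ a = \sum_(i < m) f i
    & forall m (f : nat -> A), (forall i, G i (f i)) ->
        \sum_(i < m) f i = 0 -> forall i, (i < m)%N -> f i = 0].

End Gradings.

(* The grading is arbitrary: the variables need not be homogeneous. *)
Definition weighted_homogeneous (k : fieldType) (d : nat) (g : {mpoly k[d]})
    (e : nat) : Prop :=
  exists G : nat -> set {mpoly k[d]},
    [/\ is_grading G, forall a, G 0%N a <-> exists c : k, a = c%:MP & G e g].

Definition irreducible_element (A : idomainType) (a : A) : Prop :=
  [/\ a != 0, a \isn't a GRing.unit
    & forall b c, a = b * c -> b \is a GRing.unit \/ c \is a GRing.unit].

Section ClassGroup.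
Variable R : idomainType.
Local Notation K := {fraction R}.
Local Notation "x %:F" := (@tofrac R x).

Definition integrally_closed : Prop :=
  forall x : K, integralOver (@tofrac R) x -> exists a : R, x = a%:F.

(* [idealr_closed] includes 1 \notin P. *)
Definition prime_ideal (P : set R) : Prop :=
  idealr_closed (mem P) /\ prime_idealr_closed (mem P).

Definition nonzero_ideal (P : set R) : Prop := exists2 a, P a & a != 0.

Definition height_one (P : set R) : Prop :=
  [/\ prime_ideal P, nonzero_ideal P
    & forall Q : set R, prime_ideal Q -> nonzero_ideal Q ->
        (forall a, Q a -> P a) -> Q = P].

Record prime_divisor := PrimeDivisor {
  ideal_of :> set R;
  _ : `[< height_one ideal_of >]
}.
HB.instance Definition _ := [isSub for ideal_of].
HB.instance Definition _ := [Choice of prime_divisor by <:].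

Definition local_ring (P : set R) : set K :=
  fun x => exists a b : R, ~ P b /\ x = a%:F / b%:F.

(* [v] is the normalized discrete valuation of [K] with valuation ring [R_P];
   its value at 0 is never used. *)
Definition is_valuation (P : set R) (v : K -> int) : Prop :=
  [/\ forall x y, x != 0 -> y != 0 -> v (x * y) = v x + v y,
      forall x y, x != 0 -> y != 0 -> x + y != 0 ->
        Num.min (v x) (v y) <= v (x + y),
      exists2 x, x != 0 & v x = 1
    & forall x, x != 0 -> (0 <= v x <-> local_ring P x)].

(* Total by convention: when [R] is noetherian and integrally closed, each
   [R_P] is a discrete valuation ring and the default 0 is not used. *)
Definition val_at (P : prime_divisor) : K -> int :=
  xget (fun=> 0) (is_valuation P).

Lemma val_atM (P : prime_divisor) x y :
  x != 0 -> y != 0 -> val_at P (x * y) = val_at P x + val_at P y.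
Proof. by rewrite /val_at; case: xgetP => [v _ [vM _ _ _]|_ //]; apply: vM. Qed.

Definition weil_divisor : zmodType := {freeg prime_divisor}.

Definition is_div (x : K) (D : weil_divisor) : Prop :=
  forall P, coeff P D = val_at P x.

Definition principal : weil_divisor -> bool :=
  fun D => `[< exists2 x : K, x != 0 & is_div x D >].

Lemma principal_zmod_closed : zmod_closed principal.
Proof.
split=> [|D E]; rewrite !unfold_in.
  apply/asboolP; exists 1; first exact: oner_neq0.
  move=> P; rewrite coeff0; apply/eqP.
  by rewrite -(inj_eq (addrI (val_at P 1))) addr0 -val_atM ?mulr1 ?oner_neq0.
move=> /asboolP[x x0 xD] /asboolP[y y0 yE]; apply/asboolP.
have xy0 : x / y != 0 by rewrite mulf_neq0 ?invr_neq0.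
exists (x / y) => // P; rewrite coeffB xD yE; apply/eqP.
by rewrite subr_eq -val_atM // mulfVK.
Qed.

Definition principal_divisors : zmodClosed weil_divisor :=
  HB.pack principal (GRing.isZmodClosed.Build _ principal principal_zmod_closed).

(* Despite its name, [{ideal_quot I}] is the quotient of a zmodType by any
   additive subgroup [I]. *)
Definition class_group : zmodType := {ideal_quot principal_divisors}.

(* v_P(I) = min {v_P(f) : 0 <> f in I} *)
Definition is_ideal_val (P : prime_divisor) (I : set R) (m : int) : Prop :=
  (exists2 f, I f & f != 0 /\ val_at P f%:F = m) /\
  (forall f, I f -> f != 0 -> m <= val_at P f%:F).

Definition is_ideal_div (I : set R) (D : weil_divisor) : Prop :=
  forall P, is_ideal_val P I (coeff P D).

(* Total by convention, as [val_at]; [is_ideal_div I] has at most one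
   solution. *)
Definition ideal_div (I : set R) : weil_divisor := xget 0 (is_ideal_div I).

Definition ideal_class (I : set R) : class_group :=
  \pi_class_group (ideal_div I).

Definition ideal2 (a b : R) : set R :=
  fun x => exists u v : R, x = u * a + v * b.

End ClassGroup.

Section Generation.
Variables (V : zmodType) (m : nat) (c : 'I_m -> V).

Definition generates (J : {set 'I_m}) : Prop :=
  forall x : V, exists a : 'I_m -> int, x = \sum_(i in J) c i *~ a i.

(* False when [V] is trivial and 0 < m, since the empty family generates. *)
Definition minimally_generates : Prop :=
  generates [set: 'I_m]%SET /\
  forall J : {set 'I_m}, J \proper [set: 'I_m]%SET -> ~ generates J.

End Generation.

(* Z/nZ for 0 < n; unlike 'Z_n this is the trivial group when n = 1. *)
Definition integers_mod (n : nat) : zmodType := 'I_n.-1.+1.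

Definition isomorphic_groups (U V : zmodType) : Prop :=
  exists f : {additive U -> V}, bijective f.

(* [pi] presents [R] as k[z, x_1, ..., x_d] / (z^n - g), where
   k[z, x_1, ..., x_d] is A[z] for A = k[x_1, ..., x_d]. *)
Definition presents_hypersurface (k : fieldType) (d n : nat) (g : {mpoly k[d]})
    (R : idomainType) (pi : {rmorphism {poly {mpoly k[d]}} -> R}) : Prop :=
  (forall y : R, exists p, pi p = y) /\
  (forall p, pi p = 0 <-> exists q, p = q * ('X^n - g%:P)).

(* Main.v *)
(* Give R the grading in which z has degree e and a homogeneous a in A of degree
   i has degree n i. As e is prime to n, every homogeneous element of R is a z^j
   with a in A homogeneous and j < n. Hence a homogeneous prime p of A not
   dividing g stays prime in R, while an h_i has the single prime P_i = (z, h_i)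
   above it. Localizing R at its nonzero homogeneous elements gives a Euclidean
   domain, the spread between the lowest and the highest degree being the
   Euclidean function, so Cl(R) is generated by the [P_i]. If n > 1, then g is
   square-free by normality, div(z) is the sum of the P_i and div(h_i) = n P_i.
   A principal divisor supported on the P_i is the divisor of a quotient of
   homogeneous elements, so div(z) and the div(h_i) generate all relations. *)

From HB Require Import structures.
Require Import Defs.
From mathcomp Require Import all_boot all_order all_algebra.
From mathcomp Require Import boolp classical_sets.
From mathcomp Require Import freeg mpoly.
From mathcomp Require Import ring zify.

Set Implicit Arguments.
Unset Strict Implicit.
Unset Printing Implicit Defensive.

Import Order.TTheory GRing.Theory Num.Theory.
Local Open Scope ring_scope.

(** * Factoriality of polynomial rings *)

(** The localization of R at its nonzero homogeneous elements is never built: divisibility up to a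
    nonzero homogeneous factor stands in for divisibility there. A grading of a ring [B] is carried
    as a ring morphism [B -> {poly B}], so that degrees and spreads are read off polynomials. The
    class group needs a valuation at every height one prime; each localization is shown to be a
    discrete valuation ring by exhibiting a uniformizer. This is why the height one primes are
    classified: those without nonzero homogeneous elements, the P_i, and those generated by a
    homogeneous prime of A not dividing g. As the grading of A is arbitrary, its variables give no
    hold on homogeneous elements; the hold comes from A being factorial, from factors of nonzero
    homogeneous elements being homogeneous, and from A_0 = k, which gives nonzero homogeneous
    nonunits a positive degree and makes division by homogeneous primes terminate. For n = 1 the h_i
    may repeat; then the P_i are principal and their classes vanish. *)

Lemma ex_minimizer (T : Type) (P : T -> Prop) (f : T -> nat) :
  (exists x, P x) -> exists2 x, P x & forall y, P y -> (f x <= f y)%N.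
Proof.
move=> [x Px].
have exf : exists m, `[< exists2 y, P y & f y = m >].
  by exists (f x); apply/asboolP; exists x.
case: (ex_minnP exf) => m /asboolP[y Py fy] min_m.
by exists y => // t Pt; rewrite fy min_m //; apply/asboolP; exists t.
Qed.

Section Divisibility.
Variable A : idomainType.
Implicit Types a b c p : A.

Definition divides a b := exists c, b = c * a.

Definition prime_element p := forall a b,
  divides p (a * b) -> divides p a \/ divides p b.

Lemma dividesMl a b c : divides a b -> divides a (c * b).
Proof. by move=> [u ->]; exists (c * u); rewrite mulrA. Qed.

Lemma dividesMr a b c : divides a b -> divides a (b * c).
Proof. by rewrite mulrC; apply: dividesMl. Qed.

Lemma dividesxx a : divides a a.
Proof. by exists 1; rewrite mul1r. Qed.

Lemma divides0 a : divides a 0.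
Proof. by exists 0; rewrite mul0r. Qed.

Lemma dividesD a b c : divides a b -> divides a c -> divides a (b + c).
Proof. by move=> [u ->] [v ->]; exists (u + v); rewrite mulrDl. Qed.

Lemma dividesB a b c : divides a b -> divides a c -> divides a (b - c).
Proof. by move=> [u ->] [v ->]; exists (u - v); rewrite mulrBl. Qed.

Lemma divides_trans b a c : divides a b -> divides b c -> divides a c.
Proof. by move=> ab [u ->]; apply: dividesMl. Qed.

Lemma divides_sum I (r : seq I) (P : pred I) (F : I -> A) a :
  (forall i, P i -> divides a (F i)) -> divides a (\sum_(i <- r | P i) F i).
Proof. by move=> aF; elim/big_rec: _ => [|i x /aF]; [exact: divides0|exact: dividesD]. Qed.

Lemma divides_unit a b : b \is a GRing.unit -> divides a b -> a \is a GRing.unit.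
Proof. by move=> Ub [c bE]; move: Ub; rewrite bE unitrM => /andP[]. Qed.

(** Such a [mu] vanishes, among nonzero elements, exactly at the units, so passing to a proper
    factor lowers it. It plays the part of the ascending chain condition on principal ideals. *)
Definition is_length (mu : A -> nat) :=
  (forall a b, a != 0 -> b != 0 -> mu (a * b) = (mu a + mu b)%N) /\
  (forall a, a != 0 -> mu a = 0%N -> a \is a GRing.unit).

(** Unique factorization: the length gives existence of factorizations, and primeness of
    irreducibles gives uniqueness. *)
Definition factorial :=
  (exists mu, is_length mu) /\
  forall p, irreducible_element p -> prime_element p.

Lemma length_gt0 mu a : is_length mu -> a != 0 -> a \isn't a GRing.unit -> (0 < mu a)%N.
Proof. by move=> [_ mu0] a0; rewrite lt0n; apply: contraNneq => /mu0; apply. Qed.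

(** If an element of least length in [P] factors, one factor is again in [P] and by minimality
    carries the whole length, so the other is a unit. Keeping [P] general allows both divisors of a
    given element and homogeneous elements of a prime ideal. *)
Lemma minimal_length_irreducible (mu : A -> nat) (P : A -> Prop) a :
    is_length mu -> P a -> a != 0 ->
    (forall b, P b -> b \isn't a GRing.unit) ->
    (forall b c, P (b * c) -> b * c != 0 -> P b \/ P c) ->
  exists2 p, P p & irreducible_element p.
Proof.
move=> muP Pa a0 PnU PM.
have [|p [Pp p0] min_p] := @ex_minimizer _ (fun b => P b /\ b != 0) mu; first by exists a.
exists p => //; split; rewrite ?PnU // => b c pE.
have [b0 c0] : b != 0 /\ c != 0.
  by apply/andP; move: p0; rewrite pE mulf_eq0 negb_or.
have [muM mu0] := muP.
have mupE : mu p = (mu b + mu c)%N by rewrite pE muM.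
have [||Pb|Pc] := PM b c; rewrite -?pE //.
  right; apply: mu0 => //; apply/eqP.
  by have := min_p b (conj Pb b0); rewrite mupE -[X in (_ <= X)%N -> _]addn0 leq_add2l leqn0.
left; apply: mu0 => //; apply/eqP.
by have := min_p c (conj Pc c0); rewrite mupE -[X in (_ <= X)%N -> _]add0n leq_add2r leqn0.
Qed.

Lemma irreducible_divisor mu a : is_length mu -> a != 0 -> a \isn't a GRing.unit ->
  exists2 p, irreducible_element p & divides p a.
Proof.
move=> muP a0 aNU.
have [||||p [pa pU] p_irr] := @minimal_length_irreducible mu
    (fun b => divides b a /\ b \isn't a GRing.unit) a muP.
- by split => //; apply: dividesxx.
- by [].
- by move=> b [].
- move=> b c [bca]; rewrite unitrM negb_and => /orP bcU _; case: bcU => U; [left|right].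
  by split=> //; apply: divides_trans bca; exists c; rewrite mulrC.
  by split=> //; apply: divides_trans bca; exists b.
- by exists p.
Qed.

Lemma length_divisor_gt mu p a b : is_length mu -> p \isn't a GRing.unit ->
  a != 0 -> a = b * p -> (mu b < mu a)%N.
Proof.
move=> muP pU a0 aE; have [muM _] := muP.
have [b0 p0] : b != 0 /\ p != 0 by apply/andP; move: a0; rewrite aE mulf_eq0 negb_or.
by rewrite aE muM // -[X in (X < _)%N]addn0 ltn_add2l length_gt0.
Qed.

Lemma multiplicity_length mu p a : is_length mu -> p \isn't a GRing.unit -> a != 0 ->
  exists m b, a = p ^+ m * b /\ ~ divides p b.
Proof.
move=> muP pU; have [N] := ubnP (mu a); elim: N a => // N IH a; rewrite ltnS => leN a0.
have [[b aE]|pa] := pselect (divides p a); last by exists 0%N, a; rewrite expr0 mul1r.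
have b0 : b != 0 by apply: contraNneq a0 => b0; rewrite aE b0 mul0r.
have [||m [c [bE pc]]] := IH b;
  rewrite ?(leq_trans _ leN) ?(length_divisor_gt muP pU a0 aE) //.
by exists m.+1, c; rewrite aE bE exprS; split=> //; ring.
Qed.

End Divisibility.

Lemma divides_rmorph (A B : idomainType) (f : {rmorphism A -> B}) a b :
  divides a b -> divides (f a) (f b).
Proof. by move=> [c ->]; exists (f c); rewrite rmorphM. Qed.

Section Transfer.
Variables (A B : idomainType) (f : {rmorphism A -> B}) (g : {rmorphism B -> A}).
Hypotheses (fK : cancel f g) (gK : cancel g f).

Lemma iso_unit a : (f a \is a GRing.unit) = (a \is a GRing.unit).
Proof. by apply/idP/idP => [/(rmorph_unit g)|/(rmorph_unit f)//]; rewrite fK. Qed.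

Lemma factorial_iso : factorial B -> factorial A.
Proof.
have fI := can_inj fK; have f0 a : (f a == 0) = (a == 0).
  by rewrite -(inj_eq fI) rmorph0.
move=> [[mu [muM mu0]] primeB]; split.
  exists (mu \o f); split=> [a b a0 b0|a a0 /=]; rewrite /= ?rmorphM ?muM ?f0 //.
  by move/mu0; rewrite f0 iso_unit; apply.
move=> p [p0 pU pD] a b /(divides_rmorph f); rewrite rmorphM => /primeB[].
  split; rewrite ?f0 ?iso_unit // => u v /(congr1 g); rewrite fK rmorphM => /pD.
  by rewrite -!iso_unit !gK.
  by move=> /(divides_rmorph g); rewrite !fK; left.
by move=> /(divides_rmorph g); rewrite !fK; right.
Qed.

End Transfer.

(* The lowest coefficients of P and Q that p does not divide contribute the only
   term of a coefficient of P * Q that p does not divide. *)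
Lemma prime_coef_mul (A : idomainType) (p : A) (P Q : {poly A}) :
    (forall i j, divides p (P`_i * Q`_j) -> divides p P`_i \/ divides p Q`_j) ->
    (forall k, divides p (P * Q)`_k) ->
  (forall i, divides p P`_i) \/ (forall j, divides p Q`_j).
Proof.
move=> pPQ pM; apply: contrapT => /not_orP[/existsNP exP /existsNP exQ].
have [i nPi minP] := ex_minimizer id exP; have [j nQj minQ] := ex_minimizer id exQ.
have [] // := pPQ i j _.
have := pM (i + j)%N; rewrite coefM.
have lti : (i < (i + j).+1)%N by rewrite ltnS leq_addr.
rewrite (bigD1 (Ordinal lti)) //= addKn => pS.
rewrite -[X in divides p X](addrK (\sum_(k < (i + j).+1 | k != Ordinal lti) P`_k * Q`_(i + j
    - k))).
apply: dividesB => //; apply: divides_sum => k; rewrite -val_eqE /= => neq_ki.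
have [lt_ki|le_ik] := ltnP k i.
  apply: dividesMr; apply: contrapT => /minP /=; rewrite leqNgt; by rewrite lt_ki.
apply: dividesMl; apply: contrapT => /minQ /=; apply/negP; rewrite -ltnNge.
have lt_ik : (i < k)%N by rewrite ltn_neqAle eq_sym neq_ki.
by rewrite ltn_subLR ?ltn_add2r // -ltnS ltn_ord.
Qed.

Lemma divides_polyC (A : idomainType) (p : A) (q : {poly A}) :
  divides p%:P q <-> forall i, divides p q`_i.
Proof.
split=> [[u ->] i|pq]; first by rewrite coefMC; exists u`_i.
exists (\poly_(i < size q) xget 0 (fun c => q`_i = c * p)).
apply/polyP => i; rewrite coefMC coef_poly; case: ltnP => [_|/(nth_default 0) ->];
  last by rewrite mul0r.
by case: xgetP => [y -> //|]; have [c qE] := pq i => /(_ c).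
Qed.

Lemma prime_polyC (A : idomainType) (p : A) : prime_element p -> prime_element p%:P.
Proof.
move=> pr_p P Q; rewrite !divides_polyC => pPQ.
by apply: prime_coef_mul => // i j; apply: pr_p.
Qed.

Section Gauss.
Variable A : idomainType.
Hypothesis fA : factorial A.
Implicit Types q m u : {poly A}.

(** Gauss's lemma without contents. A prime factor of [c] stays prime in [{poly A}], so it divides
    [m] or [u] and can be cancelled there; induction on the length of [c]. *)
Lemma divide_out_const (c : A) q m u : c != 0 -> c%:P * q = m * u ->
  exists c1 c2 m' u', [/\ c = c1 * c2, m = c1%:P * m', u = c2%:P * u' & q = m' * u'].
Proof.
have [[mu muP] prA] := fA.
have [N] := ubnP (mu c); elim: N c q m u => // N IH c q m u; rewrite ltnS => leN c0 qE.
have [Uc|NUc] := boolP (c \is a GRing.unit).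
  exists c, 1, (c^-1%:P * m), u; rewrite mulr1 mul1r mulrA -polyCM mulrV // mul1r; split => //.
  by rewrite -mulrA -qE mulrA -polyCM mulVr // mul1r.
have [p p_irr [b cE]] := irreducible_divisor muP c0 NUc.
have [p0 pU _] := p_irr.
have b0 : b != 0 by apply: contraNneq c0 => b0; rewrite cE b0 mul0r.
have mub : (mu b < N)%N by apply: leq_trans leN; apply: length_divisor_gt muP pU c0 cE.
have pP0 : p%:P != 0 :> {poly A} by rewrite polyC_eq0.
have [] : divides p%:P m \/ divides p%:P u.
- by apply: (prime_polyC (prA p p_irr)); rewrite -qE cE polyCM; exists (b%:P * q); ring.
- move=> [m1 mE].
  have [|c1 [c2 [m' [u' [bE m1E uE qE']]]]] := IH b q m1 u mub b0.
    by apply: (mulfI pP0); rewrite mulrA -polyCM mulrC -(mulrC b) -cE -mulrC qE mE; ring.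
  exists (c1 * p), c2, m', u'; split => //; first by rewrite cE bE; ring.
  by rewrite mE m1E polyCM; ring.
- move=> [u1 uE].
  have [|c1 [c2 [m' [u' [bE mE u1E qE']]]]] := IH b q m u1 mub b0.
    by apply: (mulfI pP0); rewrite mulrA -polyCM mulrC -(mulrC b) -cE -mulrC qE uE; ring.
  exists c1, (c2 * p), m', u'; split => //; first by rewrite cE bE; ring.
  by rewrite uE u1E polyCM; ring.
Qed.

Lemma polyC_unit (c : A) : (c%:P \is a GRing.unit) = (c \is a GRing.unit).
Proof.
rewrite poly_unitE coefC eqxx size_polyC.
by have [->|] := eqVneq c 0; rewrite ?unitr0 ?andbF.
Qed.

(** Dividing out [c] splits off a constant factor [c2] of [q]; as [q] is irreducible of positive
    degree, [c2] is a unit. *)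
Lemma const_multiple_divisor q a (c : A) : irreducible_element q -> (1 < size q)%N ->
  c != 0 -> divides q (c%:P * a) -> divides q a.
Proof.
move=> [q0 qU qD] q1 c0 [u aE].
have [c1 [c2 [u' [q' [cE uE qE aE']]]]] := divide_out_const c0 aE.
have [Uc2|Uq'] := qD _ _ qE.
  exists (u' * c2^-1%:P); rewrite aE' {1}qE.
  rewrite -[q' in LHS]mul1r -polyC1 -(mulVr (_ : c2 \is a GRing.unit)) -?polyC_unit // polyCM.
  ring.
move: q1; rewrite qE; move: Uq'; rewrite poly_unitE => /andP[/eqP sq' _].
rewrite (leq_gtF _) //; apply: leq_trans (size_polyMleq _ _) _.
by rewrite sq' addn1 size_polyC; case: (c2 == 0).
Qed.

Lemma irreducible_polyC (c : A) : irreducible_element c%:P -> irreducible_element c.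
Proof.
move=> [c0 cU cD]; split; rewrite -?(polyC_eq0 c) -?polyC_unit // => a b cE.
by rewrite -!polyC_unit; apply: cD; rewrite cE polyCM.
Qed.

(* A nonzero element [m] of least degree of the ideal (q, a) divides, up to a
   constant, both q and a. *)
Lemma irreducible_poly_prime q : irreducible_element q -> prime_element q.
Proof.
move=> q_irr a b [w qab]; have [q0 qU qD] := q_irr.
have [q1|q1] := leqP (size q) 1.
  move: q_irr qab; rewrite (size1_polyC q1) => /irreducible_polyC/(proj2 fA) pr qab.
  by apply: (prime_polyC pr); exists w.
pose J m := exists u v, m = u * q + v * a.
have [|m [Jm m0] min_m] := @ex_minimizer _ (fun m => J m /\ m != 0) (size : {poly A} -> nat).
  by exists q; split => //; exists 1, 0; ring.
have mJ f : J f -> exists2 c : A, c != 0 & divides m (c%:P * f).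
  move=> [u1 [v1 fE]]; have [u2 [v2 mE]] := Jm.
  exists (lead_coef m ^+ scalp f m); first by rewrite expf_neq0 // lead_coef_eq0.
  exists (f %/ m); rewrite mul_polyC Pdiv.Idomain.divp_eq.
  suff -> : f %% m = 0 by rewrite addr0.
  apply: contrapT => /eqP r0; have := ltn_modpN0 f m0; rewrite ltnNge.
  rewrite min_m //; split=> //.
  have -> : f %% m = (lead_coef m ^+ scalp f m)%:P * f - f %/ m * m.
    by rewrite mul_polyC Pdiv.Idomain.divp_eq addrC addKr.
  set c := (lead_coef m ^+ scalp f m)%:P; set w' := f %/ m.
  exists (c * u1 - w' * u2), (c * v1 - w' * v2).
  by rewrite [X in c * X]fE [X in w' * X]mE; ring.
have [|c c0 [u qE]] := mJ q; first by exists 1, 0; ring.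
have [|c' c'0 [u' aE]] := mJ a; first by exists 0, 1; ring.
have [c1 [c2 [u1 [m1 [cE uE mE qE']]]]] := divide_out_const c0 qE.
have c20 : c2 != 0 by apply: contraNneq c0 => c20; rewrite cE c20 mulr0.
(* Either [q] is associated to [m1], hence divides a constant multiple of [a], or [m] is the
   constant [c2] up to a unit. Then [c2] lies in the ideal (q, a), and multiplying by [b] shows that
   [q] divides [c2 b]. *)
have [Uu1|Um1] := qD _ _ qE'.
  left; apply: (const_multiple_divisor q_irr q1 c'0); rewrite aE mE.
  by exists (u' * c2%:P * u1^-1); rewrite qE' -[m1 in LHS]mul1r -(mulVr Uu1); ring.
right; apply: (const_multiple_divisor q_irr q1 c20).
have [u2 [v2 mE2]] := Jm.
have -> : c2%:P = m1^-1 * m by rewrite mE mulrCA mulVr // mulr1.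
exists (m1^-1 * (u2 * b + v2 * w)).
have -> : m1^-1 * m * b = m1^-1 * (u2 * b * q + v2 * (a * b)) by rewrite -mulrA {1}mE2;
  congr (_ * _); ring.
by rewrite qab; ring.
Qed.

Lemma factorial_poly : factorial {poly A}.
Proof.
split; last exact: irreducible_poly_prime.
have [[mu muP] _] := fA; have [muM mu0] := muP.
exists (fun p : {poly A} => ((size p).-1 + mu (lead_coef p))%N); split=> [a b a0 b0|a a0].
  rewrite lead_coefM muM ?lead_coef_eq0 // size_mul // addnACA; congr (_ + _)%N.
  by rewrite -(prednK (_ : 0 < size a)%N) ?size_poly_gt0 // -(prednK (_ :
      0 < size b)%N) ?size_poly_gt0 // addnS.
move=> /eqP; rewrite addn_eq0 => /andP[/eqP sa /eqP la].
have sa1 : size a = 1 by rewrite -(prednK (_ : 0 < size a)%N) ?size_poly_gt0 // sa.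
have aE : a`_0 = lead_coef a by rewrite lead_coefE sa1.
by rewrite poly_unitE sa1 eqxx aE mu0 // lead_coef_eq0.
Qed.

End Gauss.

Section MpolyFactorial.
Variable k : fieldType.

Lemma factorial_mpoly0 : factorial {mpoly k[0]}.
Proof.
split; first exists (fun=> 0%N).
  split=> // a a0 _.
  suff aE : a = (a@_0)%:MP.
    move: a0; rewrite aE mpolyC_eq0 => a0.
    by apply: (rmorph_unit (@mpolyC 0 k)); rewrite unitfE.
  by apply/mpolyP => m; rewrite mcoeffC (nvar0_mnmE m) eqxx mulr1.
move=> p [p0 /negP[]].
suff pE : p = (p@_0)%:MP.
  move: p0; rewrite pE mpolyC_eq0 => p0.
  by apply: (rmorph_unit (@mpolyC 0 k)); rewrite unitfE.
by apply/mpolyP => m; rewrite mcoeffC (nvar0_mnmE m) eqxx mulr1.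
Qed.

Variable n : nat.

Definition muni_inv : {rmorphism {poly {mpoly k[n]}} -> {mpoly k[n.+1]}} :=
  horner_morph (fun a => mulrC 'X_ord_max (mwiden a)).

Lemma muni_invC (a : {mpoly k[n]}) : muni_inv a%:P = mwiden a.
Proof. exact: horner_morphC. Qed.

Lemma muni_invX : muni_inv 'X = 'X_ord_max.
Proof. exact: horner_morphX. Qed.

Lemma muniK : cancel (@muni n k) muni_inv.
Proof.
move=> p; rewrite muniE rmorph_sum /= [RHS]mpolyE; apply: eq_bigr => m _.
rewrite -!mul_polyC !rmorphM /= rmorphXn /= !muni_invC muni_invX.
rewrite mwidenZ mwidenX -scalerAl mpolyXn -mpolyXD.
congr (_ *: 'X_[_]); apply/mnmP => i; rewrite mnmDE mulmnE mnm1E.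
have [->|] := eqVneq i ord_max; first by rewrite mnmwiden_ordmax mul1n.
rewrite -val_eqE /= => neq_in;
  have lt_in : (i < n)%N by rewrite ltn_neqAle neq_in -ltnS ltn_ord.
have -> : i = widen_ord (leqnSn n) (Ordinal lt_in) by apply: val_inj.
by rewrite mnmwiden_widen mnmE mul0n addn0.
Qed.

Lemma muni_monomial (m : 'X_{1..n.+1}) :
  muni 'X_[m] = 'X_[[multinom (m (widen_ord (leqnSn n) i)) | i < n]]
                *: 'X^(m ord_max) :> {poly {mpoly k[n]}}.
Proof. by rewrite muniE msuppX big_seq1 mcoeffX eqxx scale1r. Qed.

Lemma muni_mwiden (a : {mpoly k[n]}) : muni (mwiden a) = a%:P.
Proof.
rewrite (mpolyE a) (rmorph_sum (@mwiden n k)) (rmorph_sum (@muni n k)) (rmorph_sum polyC) /=.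
apply: eq_bigr => m _.
rewrite mwidenZ mwidenX muniZ muni_monomial mnmwiden_ordmax expr0 alg_polyC -mul_polyC -polyCM.
rewrite mul_mpolyC; congr (_ *: 'X_[_])%:P; apply/mnmP => i.
by rewrite mnmE mnmwiden_widen.
Qed.

Lemma muni_Xmax : muni 'X_ord_max = 'X :> {poly {mpoly k[n]}}.
Proof.
rewrite muni_monomial mnm1E eqxx expr1; set m := [multinom _ | _ < _].
have -> : m = 0%MM.
  apply/mnmP => i; rewrite mnmE mnm1E mnm0E -val_eqE /= eq_sym.
  by rewrite ltn_eqF.
by rewrite mpolyX0 scale1r.
Qed.

Lemma muni_invK : cancel muni_inv (@muni n k).
Proof.
move=> p; rewrite -[p in RHS]coefK poly_def -[p in LHS]coefK poly_def !rmorph_sum.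
apply: eq_bigr => i _; rewrite -mul_polyC !rmorphM /= !rmorphXn /=.
by rewrite muni_invC muni_invX muni_mwiden muni_Xmax.
Qed.

End MpolyFactorial.

Lemma factorial_mpoly (k : fieldType) (n : nat) : factorial {mpoly k[n]}.
Proof.
elim: n => [|n IH]; first exact: factorial_mpoly0.
exact: (factorial_iso (@muniK k n) (@muni_invK k n) (factorial_poly IH)).
Qed.

(** * Gradings *)

Section Width.
Variable B : idomainType.
Implicit Types p q : {poly B}.

Definition low_degree q := find (fun c => c != 0) (q : seq B).

(** Both extreme degrees are counted: a nonzero monomial has width 1, and [width - 1] is additive on
    products of nonzero polynomials. *)
Definition width q := (size q - low_degree q)%N.

Lemma low_degree_lt q : q != 0 -> (low_degree q < size q)%N.
Proof.
move=> q0; rewrite /low_degree -has_find; apply/hasP.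
by exists (lead_coef q);
  rewrite ?lead_coef_eq0 // lead_coefE mem_nth // prednK // size_poly_gt0.
Qed.

Lemma coef_low_degree q : q != 0 -> q`_(low_degree q) != 0.
Proof. by move=> /low_degree_lt; rewrite -has_find => /(nth_find 0). Qed.

Lemma coef_lt_low_degree q i : (i < low_degree q)%N -> q`_i = 0.
Proof. by move=> /(before_find 0)/negbFE/eqP. Qed.

Lemma low_degree_geq q m : q != 0 -> (forall i, (i < m)%N -> q`_i = 0) ->
    (m <= low_degree q)%N.
Proof.
by move=> q0 qm; rewrite leqNgt; apply: contra_neqN (coef_low_degree q0) => /qm.
Qed.

Lemma low_degreeM p q : p != 0 -> q != 0 ->
    low_degree (p * q) = (low_degree p + low_degree q)%N.
Proof.
move=> p0 q0; set a := low_degree p; set b := low_degree q.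
have pq0 : p * q != 0 by rewrite mulf_neq0.
apply/eqP; rewrite eqn_leq andbC low_degree_geq //=.
  rewrite leqNgt; apply/negP => /coef_lt_low_degree; rewrite coefM.
  have lta : (a < (a + b).+1)%N by rewrite ltnS leq_addr.
  rewrite (bigD1 (Ordinal lta)) //= addKn big1 ?addr0 => [/eqP|i].
    by rewrite mulf_eq0 !(negbTE (coef_low_degree _)).
  rewrite -val_eqE /= => neq_ia.
  have [lt_ia|le_ai] := ltnP i a; first by rewrite coef_lt_low_degree ?mul0r.
  by rewrite [X in _ * X]coef_lt_low_degree ?mulr0 // -/b; have := ltn_ord i; lia.
move=> i lti; rewrite coefM big1 // => j _.
have [lt_ja|le_aj] := ltnP j a; first by rewrite coef_lt_low_degree ?mul0r.
rewrite [X in _ * X]coef_lt_low_degree ?mulr0 // -/b; have := ltn_ord j. lia.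
Qed.

Lemma width_gt0 q : q != 0 -> (0 < width q)%N.
Proof. by move=> /low_degree_lt; rewrite subn_gt0. Qed.

Lemma widthM p q : p != 0 -> q != 0 -> (width (p * q)).+1 = (width p + width q)%N.
Proof.
move=> p0 q0; have := low_degree_lt p0; have := low_degree_lt q0.
by rewrite /width size_mul // low_degreeM //; lia.
Qed.

Lemma width_monomial (a : B) i : a != 0 -> width (a *: 'X^i) = 1%N.
Proof.
move=> a0; rewrite /width size_scale // size_polyXn.
have aX0 : a *: 'X^i != 0 :> {poly B} by rewrite -size_poly_eq0 size_scale // size_polyXn.
suff -> : low_degree (a *: 'X^i) = i by rewrite subSnn.
apply/eqP; rewrite eqn_leq low_degree_geq ?andbT //.
  by rewrite -ltnS -(size_polyXn B i) -(size_scale 'X^i a0) low_degree_lt.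
by move=> j ltj; rewrite coefZ coefXn ltn_eqF // mulr0.
Qed.

Lemma width1_monomial q : width q = 1%N -> q = lead_coef q *: 'X^((size q).-1).
Proof.
move=> w1; apply/polyP => i; rewrite coefZ coefXn lead_coefE.
have [->|neq_i] := eqVneq i (size q).-1; first by rewrite mulr1.
rewrite mulr0; have [/(nth_default 0) //|lti] := leqP (size q) i.
by apply: coef_lt_low_degree; move: w1; rewrite /width; lia.
Qed.

End Width.

Section Graded.
Variables (B : idomainType) (phi : {rmorphism B -> {poly B}}).

(* A grading of [B], as the map sending [a], with components [a_i], to
   [\sum_i a_i X^i]. *)
Definition is_cograding :=
  (forall a, (phi a).[1] = a) /\ (forall a i, phi (phi a)`_i = (phi a)`_i *: 'X^i).

Hypothesis phiP : is_cograding.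
Implicit Types (a b f s t y : B) (P Q : set B).

Definition homogeneous a := exists i, phi a = a *: 'X^i.

Definition spread a := width (phi a).

Lemma cograding_inj : injective phi.
Proof. by move=> a b ab; rewrite -(phiP.1 a) ab phiP.1. Qed.

Lemma cograding_eq0 a : (phi a == 0) = (a == 0).
Proof. by rewrite -(inj_eq cograding_inj) rmorph0. Qed.

Lemma homogeneous_coef a i : homogeneous (phi a)`_i.
Proof. by exists i; apply: phiP.2. Qed.

Lemma homogeneous1 : homogeneous 1.
Proof. by exists 0%N; rewrite rmorph1 expr0 scale1r. Qed.

Lemma homogeneousM a b : homogeneous a -> homogeneous b -> homogeneous (a * b).
Proof.
move=> [i aE] [j bE]; exists (i + j)%N.
by rewrite rmorphM aE bE -!mul_polyC polyCM exprD; ring.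
Qed.

Lemma spread_gt0 a : a != 0 -> (0 < spread a)%N.
Proof. by move=> a0; rewrite width_gt0 // cograding_eq0. Qed.

Lemma spreadM a b : a != 0 -> b != 0 -> (spread (a * b)).+1 = (spread a + spread b)%N.
Proof. by move=> a0 b0; rewrite /spread rmorphM widthM // cograding_eq0. Qed.

Lemma spread_homogeneous a : a != 0 -> homogeneous a -> spread a = 1%N.
Proof. by move=> a0 [i aE]; rewrite /spread aE width_monomial. Qed.

Lemma spread1_homogeneous a : spread a = 1%N -> homogeneous a.
Proof.
move=> /width1_monomial; move: (lead_coef _) (size _).-1 => c m aE; exists m.
suff cE : c = a by rewrite aE {1}cE.
by rewrite -[RHS](phiP.1 a) aE hornerZ hornerXn expr1n mulr1.
Qed.

(** On nonzero elements [spread - 1] is additive, nonnegative, and zero exactly at the homogeneous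
    ones. *)
Lemma homogeneous_factor a b : a * b != 0 -> homogeneous (a * b) ->
  homogeneous a /\ homogeneous b.
Proof.
move=> ab0 /(spread_homogeneous ab0) sab.
have /andP[a0 b0] : (a != 0) && (b != 0) by rewrite -negb_or -mulf_eq0.
have := spreadM a0 b0; have := spread_gt0 a0; have := spread_gt0 b0; rewrite sab => sb sa sE.
by split; apply: spread1_homogeneous; lia.
Qed.

(* Cancel the top components of [f] and [y]. *)
Lemma homogeneous_pseudo_division f y : f != 0 -> y != 0 -> (spread f <= spread y)%N ->
  exists s t, [/\ s != 0, homogeneous s
    & s * y - t * f = 0 \/ (spread (s * y - t * f) < spread y)%N].
Proof.
move=> f0 y0; have := f0; have := y0; rewrite -!cograding_eq0 /spread => py0 pf0 le_fy.
set m := (size (phi f)).-1; set l := (size (phi y)).-1.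
exists (phi f)`_m, (phi y)`_l; split; last 1 first.
- have [|r0] := eqVneq ((phi f)`_m * y - (phi y)`_l * f) 0; [by left|right].
  move: r0; rewrite -cograding_eq0 rmorphB !rmorphM !phiP.2 => r0.
  set r := (X in width X); have rE i : r`_i =
      (if (i < m)%N then 0 else (phi f)`_m * (phi y)`_(i - m)) -
      (if (i < l)%N then 0 else (phi y)`_l * (phi f)`_(i - l)).
    rewrite /r coefB -!scalerAl !coefZ !(mulrC 'X^_) !coefMXn.
    by do 2!case: ifP; rewrite ?mulr0.
  have szf : size (phi f) = m.+1 by rewrite prednK // size_poly_gt0.
  have szy : size (phi y) = l.+1 by rewrite prednK // size_poly_gt0.
  have ltf := low_degree_lt pf0; have lty := low_degree_lt py0.
  have szr : (size r <= m + l)%N.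
    apply/leq_sizeP => j; rewrite leq_eqVlt rE => /orP[/eqP <-|ltj].
      by rewrite !ltnNge leq_addr leq_addl /= addKn addnK mulrC subrr.
    rewrite !ifF; [|lia|lia].
    rewrite [(phi y)`_(j - m)]nth_default ?[(phi f)`_(j - l)]nth_default ?mulr0 ?subrr //;
      rewrite ?szf ?szy; lia.
  (* In [r] the polynomial [phi y] is shifted by [m] and [phi f] by [l]. The assumption on the
     spreads says precisely that the second shift does not start below the first. *)
  have ldr : (m + low_degree (phi y) <= low_degree r)%N.
    apply: low_degree_geq => // i lti; rewrite rE.
    case: ifP => [lt_im|ge_im].
      case: ifP => [_|ge_il];
        rewrite ?subrr // sub0r [(phi f)`_(i - l)]coef_lt_low_degree ?mulr0 ?oppr0 //.
      by move: le_fy; rewrite /width szf szy; lia.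
    rewrite [(phi y)`_(i - m)]coef_lt_low_degree; last by lia.
    case: ifP => [_|ge_il];
      rewrite ?mulr0 ?subrr // sub0r [(phi f)`_(i - l)]coef_lt_low_degree ?mulr0 ?oppr0 //.
    by move: le_fy; rewrite /width szf szy; lia.
  rewrite /width szy (leq_ltn_trans (leq_sub szr ldr)) // subnDl subSn //.
  by rewrite -ltnS -szy.
- by rewrite -lead_coefE lead_coef_eq0.
- exact: homogeneous_coef.
Qed.

(** Divisibility of [y] by [f] in the localization at the nonzero homogeneous elements. *)
Definition divides_up_to_homogeneous f y :=
  exists s, [/\ s != 0, homogeneous s & divides f (s * y)].

(** The Euclidean argument: [f] is a nonzero element of [I] of least spread. Remainders of
    pseudo-division by [f] stay in [I] and lose spread, so repeating the division ends at 0. *)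
Lemma ideal_generator (I : B -> Prop) :
    (forall a b, I a -> I b -> I (a - b)) -> (forall a b, I b -> I (a * b)) ->
    (exists2 y, I y & y != 0) ->
  exists f, [/\ I f, f != 0 & forall y, I y -> divides_up_to_homogeneous f y].
Proof.
move=> IB IM [y Iy y0].
have [|f [If f0] min_f] := @ex_minimizer _ (fun f => I f /\ f != 0) spread; first by exists y.
exists f; split => // {y y0} {}y {}Iy.
have [N] := ubnP (spread y); elim: N y Iy => // N IH y Iy; rewrite ltnS => leN.
have [->|y0] := eqVneq y 0.
  by exists 1; split; [exact: oner_neq0|exact: homogeneous1|rewrite mulr0; apply: divides0].
have [|s [t [s0 hs rP]]] := homogeneous_pseudo_division f0 y0.
  exact: min_f.
have [s' [s'0 hs' [q qE]]] : divides_up_to_homogeneous f (s * y - t * f).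
  case: rP => [->|ltr]; last by apply: IH; [apply: IB; apply: IM|apply: leq_trans leN].
  by exists 1; split; [exact: oner_neq0|exact: homogeneous1|rewrite mulr0; apply: divides0].
exists (s' * s); split; [by rewrite mulf_neq0|exact: homogeneousM|].
exists (q + s' * t); rewrite mulrDl -qE; ring.
Qed.

End Graded.

Lemma rmorphism_ex (A B : comNzRingType) (f : A -> B) :
  {morph f : x y / x - y} -> f 1 = 1 -> {morph f : x y / x * y} ->
  exists F : {rmorphism A -> B}, F =1 f.
Proof.
move=> fB f1 fM.
pose F : {rmorphism A -> B} := HB.pack f (GRing.isZmodMorphism.Build _ _ f fB)
  (GRing.isMonoidMorphism.Build _ _ f (conj f1 fM)).
by exists F.
Qed.

Section Cograding.
Variables (A : idomainType) (G : nat -> set A).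
Hypotheses (grG : is_grading G) (G1 : G 0%N 1).

Let G0 i : G i 0. Proof. by have [GZ _ _ _] := grG; have [] := GZ i. Qed.
Let GB i a b : G i a -> G i b -> G i (a - b).
Proof. by have [GZ _ _ _] := grG; have [_] := GZ i; apply. Qed.
Let GD i a b : G i a -> G i b -> G i (a + b).
Proof. by move=> Ga Gb; rewrite -[b]opprK -[- b]sub0r; do 2?apply: (GB) => //. Qed.

Definition components (p : {poly A}) := forall i, G i p`_i.

Lemma components_ex a : exists p, components p /\ p.[1] = a.
Proof.
have [_ _ Gex _] := grG; have [m [f [Gf ->]]] := Gex a.
exists (\poly_(i < m) f i); split=> [i|]; first by rewrite coef_poly; case: ifP.
rewrite (horner_coef_wide _ (size_poly _ _)); apply: eq_bigr => i _.
by rewrite coef_poly ltn_ord expr1n mulr1.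
Qed.

Lemma componentsB p q : components p -> components q -> components (p - q).
Proof. by move=> Gp Gq i; rewrite coefB; apply: GB. Qed.

Lemma components_inj p q : components p -> components q -> p.[1] = q.[1] -> p = q.
Proof.
move=> Gp Gq pq; apply/eqP; rewrite -subr_eq0; apply/eqP.
have [_ _ _ Guniq] := grG; have Gr := componentsB Gp Gq.
apply/polyP => i; rewrite coef0; have [lti|/(nth_default 0) //] := ltnP i (size (p - q)).
apply: (Guniq (size (p - q)) (fun i => (p - q)`_i) Gr) => //.
transitivity (p - q).[1]; last by rewrite hornerD hornerN pq subrr.
by rewrite horner_coef; apply: eq_bigr => j _; rewrite expr1n mulr1.
Qed.

Lemma componentsM p q : components p -> components q -> components (p * q).
Proof.
move=> Gp Gq i; rewrite coefM; elim/big_rec: _ => [|j x _ Gx]; first exact: G0.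
apply: GD => //; have [_ GM _ _] := grG.
by rewrite -[i in G i _](subnKC (leq_ord j)); apply: GM.
Qed.

Lemma components_monomial i a : G i a -> components (a *: 'X^i).
Proof.
move=> Ga j; rewrite coefZ coefXn; case: eqVneq => [->|_]; first by rewrite mulr1.
by rewrite mulr0; apply: G0.
Qed.

(** The polynomials whose coefficient of index i lies in [G i] form a subring, which evaluation at 1
    maps bijectively onto [A]; [phi] is the inverse of this ring morphism. *)
Lemma cograding_ex : exists phi : {rmorphism A -> {poly A}},
  [/\ is_cograding phi, forall i a, G i a -> phi a = a *: 'X^i
    & forall i a, phi a = a *: 'X^i -> G i a].
Proof.
have [f fP] : exists f : A -> {poly A}, forall a, components (f a) /\ (f a).[1] = a.
  by exists (fun a => projT1 (cid (components_ex a))) => a; case: cid.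
have fE p a : components p -> p.[1] = a -> f a = p.
  by move=> Gp pa; apply: components_inj => //; [apply: (fP a).1|rewrite (fP a).2].
have [||| phi phiE] := @rmorphism_ex A {poly A} f.
- move=> a b; apply: fE; first by apply: componentsB; apply: (fP _).1.
  by rewrite hornerD hornerN !(fP _).2.
- apply: fE; last by rewrite hornerC.
  have -> : 1 = 1 *: 'X^0 :> {poly A} by rewrite expr0 scale1r.
  exact: components_monomial.
- move=> a b; apply: fE; first by apply: componentsM; apply: (fP _).1.
  by rewrite hornerM !(fP _).2.
have phiG i a : G i a -> phi a = a *: 'X^i.
  move=> Ga; rewrite phiE; apply: fE; first exact: components_monomial.
  by rewrite hornerZ hornerXn expr1n mulr1.
exists phi; split=> //.
  split=> a; first by rewrite phiE (fP a).2.
  by move=> i; apply: phiG; rewrite phiE; apply: (fP a).1.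
move=> i a aE.
suff -> : a = (phi a)`_i by rewrite phiE; apply: (fP a).1.
by rewrite aE coefZ coefXn eqxx mulr1.
Qed.

End Cograding.

(** * Uniformizers and the class group *)

Section Fractions.
Variable R : idomainType.
Local Notation "x %:F" := (@tofrac R x).

Lemma fraction_ex (x : {fraction R}) : exists a b, b != 0 /\ x = a%:F / b%:F.
Proof.
elim/quotW: x => r; have d0 := denom_ratioP r.
exists \n_r, \d_r; split=> //; have F0 : (\d_r)%:F != 0 by rewrite tofrac_eq0.
apply: (mulIf F0); rewrite mulfVK //; unlock tofrac.
rewrite !piE; apply/eqP; rewrite piE /= FracField.equivfE /mulf /=.
rewrite !numden_Ratio ?oner_neq0 ?mulr1 //.
  by rewrite mulrC.
Qed.

End Fractions.

Section Uniformizers.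
Variable R : idomainType.
Implicit Types (a b s t u y : R) (P Q : set R).
Local Notation "x %:F" := (@tofrac R x).

Lemma prime_idealP P : prime_ideal P <->
  [/\ P 0, ~ P 1, forall a b, P a -> P b -> P (a + b), forall a b, P b -> P (a * b)
    & forall a b, P (a * b) -> P a \/ P b].
Proof.
split=> [[[P0 P1 PD] PM]|[P0 P1 PD PZ PM]].
  have {}P0 : P 0 by apply: set_mem.
  split=> // [/mem_set P1'|a b Pa Pb|a b Pb|a b Pab].
  - by move: P1; rewrite /= P1'.
  - by rewrite -[a]mul1r; apply: set_mem; apply: PD; apply: mem_set.
  - by rewrite -[_ * _]addr0; apply: set_mem; apply: PD; apply: mem_set.
  - by have /orP[/set_mem|/set_mem] := PM a b (mem_set Pab); [left|right].
split; first split.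
- exact: mem_set.
- by apply/negP => /set_mem.
- by move=> a x y /set_mem Px /set_mem Py; apply/mem_set/PD => //; apply: PZ.
- by move=> a b /set_mem/PM[Pa|Pb]; apply/orP; [left|right]; apply: mem_set.
Qed.

Section PrimeTheory.
Variable P : set R.
Hypothesis prP : prime_ideal P.

Lemma prime0 : P 0. Proof. by have /prime_idealP[] := prP. Qed.
Lemma prime1 : ~ P 1. Proof. by have /prime_idealP[] := prP. Qed.
Lemma primeD a b : P a -> P b -> P (a + b).
Proof. by have /prime_idealP[] := prP; move=> _ _ PD _ _; apply: PD. Qed.
Lemma primeMl a b : P b -> P (a * b).
Proof. by have /prime_idealP[] := prP; move=> _ _ _ PM _; apply: PM. Qed.
Lemma primeMr a b : P a -> P (a * b).
Proof. by rewrite mulrC; apply: primeMl. Qed.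
Lemma primeB a b : P a -> P b -> P (a - b).
Proof. by move=> Pa Pb; rewrite -mulN1r; apply: primeD => //; apply: primeMl. Qed.
Lemma primeM a b : P (a * b) -> P a \/ P b.
Proof. by have /prime_idealP[] := prP; move=> _ _ _ _; apply. Qed.
Lemma primeNM a b : ~ P a -> ~ P b -> ~ P (a * b).
Proof. by move=> nPa nPb /primeM[]. Qed.
Lemma primeX a m : P (a ^+ m) -> P a.
Proof. by elim: m => [/prime1 //|m IH]; rewrite exprS => /primeM[]. Qed.
Lemma primeDr a b : P b -> P (a + b) -> P a.
Proof. by move=> Pb Pab; rewrite -[a](addrK b); apply: primeB. Qed.

Lemma prime_neq0 a : ~ P a -> a != 0.
Proof. by apply: contra_not_neq => ->; apply: prime0. Qed.

End PrimeTheory.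

(** In [R_P] this says that [y] is [t ^+ m] times a unit; clearing denominators keeps the equation
    in [R]. *)
Definition has_order P t y m := exists s u, [/\ ~ P s, ~ P u & s * y = t ^+ m * u].

(* The localization of [R] at [P] is a discrete valuation ring with
   uniformizer [t]. *)
Definition uniformizer P t :=
  [/\ prime_ideal P, P t, t != 0 & forall y, y != 0 -> exists m, has_order P t y m].

Section PrimeOrder.
Variables (P : set R) (t : R).
Hypothesis prP : prime_ideal P.

Lemma has_orderM y y' m m' : has_order P t y m -> has_order P t y' m' ->
  has_order P t (y * y') (m + m').
Proof.
move=> [s [u [nPs nPu yE]]] [s' [u' [nPs' nPu' yE']]].
exists (s * s'), (u * u'); split; [exact: primeNM|exact: primeNM|].
by rewrite mulrACA yE yE' exprD; ring.
Qed.

Lemma has_order_exp m : has_order P t (t ^+ m) m.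
Proof. by exists 1, 1; rewrite mulr1 mul1r; split => //; apply: prime1. Qed.

Lemma has_order_notin y : ~ P y -> has_order P t y 0.
Proof. by move=> nPy; exists 1, y; rewrite !mul1r; split => //; apply: prime1. Qed.

Lemma has_orderD_lt y y' m m' : P t ->
  has_order P t y m -> has_order P t y' m' -> (m < m')%N ->
  has_order P t (y + y') m.
Proof.
move=> P_t [s [u [nPs nPu yE]]] [s' [u' [nPs' nPu' yE']]] ltm.
exists (s * s'), (s' * u + t * (t ^+ (m' - m.+1) * s * u')); split.
- exact: primeNM.
- by move=> /(primeDr prP (primeMr prP _ P_t)); apply: primeNM.
- have tE : t ^+ m' = t ^+ m * t * t ^+ (m' - m.+1) by rewrite -exprSr -exprD subnKC.
  by rewrite mulrDr mulrAC yE -mulrA yE' tE; ring.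
Qed.

End PrimeOrder.

Section Order.
Variables (P : set R) (t : R).
Hypothesis Pt : uniformizer P t.
Let prP : prime_ideal P. Proof. by have [] := Pt. Qed.
Let P_t : P t. Proof. by have [] := Pt. Qed.
Let t0 : t != 0. Proof. by have [] := Pt. Qed.

Lemma has_order_leq y m m' : has_order P t y m -> has_order P t y m' -> (m' <= m)%N.
Proof.
move=> [s [u [nPs nPu yE]]] [s' [u' [nPs' nPu' yE']]]; rewrite leqNgt; apply/negP => ltm.
apply: (primeNM prP nPs' nPu).
have -> : s' * u = t * (t ^+ (m' - m.+1) * u' * s).
  apply: (mulfI (expf_neq0 m t0)).
  have tE : t ^+ m' = t ^+ m * t * t ^+ (m' - m.+1) by rewrite -exprSr -exprD subnKC.
  by rewrite mulrCA -yE mulrCA yE' tE; ring.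
exact: primeMr.
Qed.

Lemma has_order_inj y m m' : has_order P t y m -> has_order P t y m' -> m = m'.
Proof. by move=> ym ym'; apply/eqP; rewrite eqn_leq !(@has_order_leq y). Qed.

Lemma has_order_gt0 y m : has_order P t y m -> P y <-> (0 < m)%N.
Proof.
move=> [s [u [nPs nPu yE]]]; split=> [Py|m_gt0].
  rewrite lt0n; apply/eqP => m0; apply: nPu; rewrite -[u]mul1r -(expr0 t) -m0 -yE.
  exact: primeMl.
have [//|] : P s \/ P y; last by [].
by apply: (primeM prP); rewrite yE -(prednK m_gt0) exprS -mulrA; apply: primeMr.
Qed.

Lemma has_orderD_leq y y' k m m' : has_order P t y m -> has_order P t y' m' ->
  has_order P t (y + y') k -> (minn m m' <= k)%N.
Proof.
move=> ym ym' yk.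
have [ltm|ltm|eqm] := ltngtP m m'.
- by rewrite (has_order_inj yk (has_orderD_lt prP P_t ym ym' ltm)).
- by rewrite addrC in yk; rewrite (has_order_inj yk (has_orderD_lt prP P_t ym' ym ltm)).
rewrite -{m'}eqm in ym' *.
have [s [u [nPs nPu yE]]] := ym; have [s' [u' [nPs' nPu' yE']]] := ym'.
have [_ _ _ ord_ex] := Pt.
have E : s * s' * (y + y') = t ^+ m * (s' * u + s * u').
  by rewrite mulrDr mulrAC yE -mulrA yE'; ring.
(* If the second factor vanishes then [y + y' = 0], which has no order: a power of [t] times an
   element outside [P] is nonzero. *)
have [w0|w0] := eqVneq (s' * u + s * u') 0.
  move: yk => [s1 [u1 [nPs1 nPu1]]].
  have -> : y + y' = 0.
    apply: (mulfI (prime_neq0 prP (primeNM prP nPs nPs'))); by rewrite E w0 !mulr0.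
  rewrite mulr0 => /esym/eqP; rewrite mulf_eq0 expf_eq0 (negbTE t0) andbF /=.
  by rewrite (negbTE (prime_neq0 prP nPu1)).
have [j wj] := ord_ex _ w0.
have Ej : has_order P t (s * s' * (y + y')) (m + j).
  by rewrite E; apply: (has_orderM prP) => //; apply: (has_order_exp _ prP).
have Ek : has_order P t (s * s' * (y + y')) k.
  by rewrite -[k]add0n; apply: (has_orderM prP) => //; apply: has_order_notin => //;
    apply: primeNM.
by rewrite (has_order_inj Ek Ej) leq_addr.
Qed.

(** A nonzero element of a prime [Q] inside [P] is a power of [t] up to elements outside [P], hence
    outside [Q]. So [Q] contains [t], and then every element of [P]. *)
Lemma uniformizer_height_one : height_one P.
Proof.
split; [exact: prP|by exists t|move=> Q prQ [y Qy y0] QP].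
have [_ _ _ ord_ex] := Pt.
have Qt : Q t.
  have [m [s [u [nPs nPu yE]]]] := ord_ex _ y0.
  have /(primeM prQ)[/(primeX prQ) //|/QP //] : Q (t ^+ m * u).
  by rewrite -yE; apply: primeMl.
apply/seteqP; split=> // x Px; have [->|x0] := eqVneq x 0; first exact: prime0.
have [m xm] := ord_ex _ x0; have m_gt0 := (has_order_gt0 xm).1 Px.
move: xm => [s [u [nPs nPu xE]]].
have [/QP //|//] : Q s \/ Q x; apply: (primeM prQ).
by rewrite xE -(prednK m_gt0) exprS -mulrA; apply: primeMr.
Qed.

Let ord y := xget 0%N (has_order P t y).

Let ordP y : y != 0 -> has_order P t y (ord y).
Proof. by have [_ _ _ H] := Pt; move=> /H[m ym]; rewrite /ord; case: xgetP => // /(_ m). Qed.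

(** Independent of the fraction chosen, because orders are unique and additive. *)
Let val (x : {fraction R}) : int :=
  xget 0 (fun k => exists a b, [/\ a != 0, b != 0, x = a%:F / b%:F
                                 & k = (ord a)%:Z - (ord b)%:Z]).

Let valE a b : a != 0 -> b != 0 -> val (a%:F / b%:F) = (ord a)%:Z - (ord b)%:Z.
Proof.
move=> a0 b0; rewrite /val; case: xgetP => [k _|/(_ ((ord a)%:Z - (ord b)%:Z))]; last first.
  by case; exists a, b.
move=> [c [d [c0 d0 /eqP E ->]]].
rewrite eqr_div ?tofrac_eq0 // -!tofracM tofrac_eq in E.
have := has_orderM prP (ordP a0) (ordP d0); rewrite (eqP E) => /has_order_inj.
by move=> /(_ _ (has_orderM prP (ordP c0) (ordP b0))); lia.
Qed.

Lemma fraction_neq0_ex (x : {fraction R}) : x != 0 ->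
  exists a b, [/\ a != 0, b != 0 & x = a%:F / b%:F].
Proof.
have [a [b [b0 ->]]] := fraction_ex x => ab0; exists a, b; split=> //.
by apply: contraNneq ab0 => ->; rewrite tofrac0 mul0r.
Qed.

Lemma uniformizer_valuation : exists v, is_valuation P v.
Proof.
exists val; split.
- move=> x y /fraction_neq0_ex[a [b [a0 b0 ->]]] /fraction_neq0_ex[c [d [c0 d0 ->]]].
  rewrite mulf_div -!tofracM !valE ?mulf_neq0 //.
  rewrite (has_order_inj (ordP (mulf_neq0 a0 c0)) (has_orderM prP (ordP a0) (ordP c0))).
  rewrite (has_order_inj (ordP (mulf_neq0 b0 d0)) (has_orderM prP (ordP b0) (ordP d0))).
  lia.
- move=> x y /fraction_neq0_ex[a [b [a0 b0 ->]]] /fraction_neq0_ex[c [d [c0 d0 ->]]].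
  rewrite addf_div ?tofrac_eq0 // -!tofracM -tofracD => xy0.
  have n0 : a * d + c * b != 0.
    by apply: contraNneq xy0 => ->; rewrite tofrac0 mul0r.
  rewrite !valE ?mulf_neq0 //.
  rewrite (has_order_inj (ordP (mulf_neq0 b0 d0)) (has_orderM prP (ordP b0) (ordP d0))).
  have := has_orderD_leq (has_orderM prP (ordP a0) (ordP d0)) (has_orderM prP (ordP c0) (ordP
      b0)) (ordP n0).
  by rewrite geq_min minElt; move: (ord _) (ord a) (ord b) (ord c) (ord d) => i j k l m;
    case: ifP; lia.
- exists t%:F; first by rewrite tofrac_eq0.
  rewrite -[t%:F]divr1 -tofrac1 valE ?oner_neq0 //.
  rewrite (has_order_inj (ordP (oner_neq0 R)) (has_order_exp t prP 0)).
  by rewrite (has_order_inj (ordP t0) (has_order_exp t prP 1)).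
- move=> x /fraction_neq0_ex[a [b [a0 b0 ->]]]; rewrite valE //; split.
    move=> le_ba; have [sa [ua [nPsa nPua aE]]] := ordP a0.
    have [sb [ub [nPsb nPub bE]]] := ordP b0.
    exists (t ^+ (ord a - ord b) * ua * sb), (ub * sa); split; first exact: primeNM.
    have [sa0 ub0] := (prime_neq0 prP nPsa, prime_neq0 prP nPub).
    apply/eqP; rewrite eqr_div ?tofrac_eq0 ?mulf_neq0 // -!tofracM tofrac_eq.
    have -> : a * (ub * sa) = ub * (sa * a) by ring.
    have -> : t ^+ (ord a - ord b) * ua * sb * b = t ^+ (ord a - ord b) * ua * (sb * b)
        by ring.
    have le_ba' : (ord b <= ord a)%N by lia.
    by rewrite aE bE -{1}(subnKC le_ba') exprD; apply/eqP; ring.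
  move=> [c [d [nPd E]]]; have d0 := prime_neq0 prP nPd.
  have c0 : c != 0.
    apply/eqP => c0; move/eqP: E; rewrite c0 tofrac0 mul0r mulf_eq0 invr_eq0 !tofrac_eq0.
    by rewrite (negbTE a0) (negbTE b0).
  rewrite -valE // E valE // (has_order_inj (ordP d0) (has_order_notin t prP nPd)); lia.
Qed.

End Order.

Lemma val_at_div (P : prime_divisor R) (x y : {fraction R}) : x != 0 -> y != 0 ->
  val_at P (x / y) = val_at P x - val_at P y.
Proof.
move=> x0 y0; rewrite -{2}(divfK y0 x) (val_atM P _ y0) ?addrK //.
by rewrite mulf_neq0 ?invr_eq0.
Qed.

Section ValAt.
Variables (P : prime_divisor R) (t : R).
Hypothesis Pt : uniformizer P t.
Let prP : prime_ideal P. Proof. by have [] := Pt. Qed.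

(** [val_at P] is an arbitrary choice among the functions meeting the specification, so its values
    must be forced. Such a [v] is 0 outside [P], hence is [v t] times the order on nonzero elements;
    since [v] takes the value 1 and [v t] is nonnegative, [v t = 1]. *)
Lemma val_at_order y m : has_order P t y m -> val_at P y%:F = m%:Z.
Proof.
rewrite /val_at; case: xgetP => [v _ [vM _ v1 v0] ym|Nv]; last first.
  by have [v] := uniformizer_valuation Pt; move/Nv.
have vu s : ~ ideal_of P s -> v s%:F = 0.
  move=> nPs; have s0 : s%:F != 0 by rewrite tofrac_eq0 (prime_neq0 prP).
  have v_1 : v 1 = 0 by have := vM 1 1 (oner_neq0 _) (oner_neq0 _); rewrite mulr1; lia.
  have := vM _ _ s0 (invr_neq0 s0); rewrite mulfV // v_1.
  have /(v0 _ s0) : local_ring P s%:F.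
    by exists s, 1; rewrite tofrac1 divr1; split=> //; apply: prime1.
  have /(v0 _ (invr_neq0 s0)) : local_ring P (s%:F)^-1.
    by exists 1, s; rewrite tofrac1 mul1r.
  lia.
have t0 : t%:F != 0 by have [_ _ t0 _] := Pt; rewrite tofrac_eq0.
have vX j : v (t%:F ^+ j) = v t%:F * j%:Z.
  elim: j => [|j IH]; first by rewrite expr0 mulr0 -tofrac1 vu //; apply: prime1.
  by rewrite exprS vM ?expf_neq0 // IH intS mulrDr mulr1.
have vE z j : has_order P t z j -> v z%:F = v t%:F * j%:Z.
  move=> [s [u [nPs nPu zE]]].
  have [s0 u0] := (prime_neq0 prP nPs, prime_neq0 prP nPu).
  have z0 : z != 0.
    apply: contraNneq t0 => z0; move/esym/eqP: zE; rewrite z0 mulr0 mulf_eq0 (negbTE u0) orbF.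
    by rewrite expf_eq0 tofrac_eq0 => /andP[].
  move/(congr1 (@tofrac R)): zE; rewrite !tofracM tofracXn => /(congr1 v).
  rewrite -tofrac_eq0 in s0; rewrite -tofrac_eq0 in u0; rewrite -tofrac_eq0 in z0.
  by rewrite (vM _ _ s0 z0) (vM _ _ (expf_neq0 _ t0) u0) vX (vu s) // (vu u) // add0r addr0.
have vt : 0 <= v t%:F.
  by apply/v0 => //; exists t, 1; rewrite tofrac1 divr1; split => //; apply: prime1.
suff v1' : v t%:F = 1 by rewrite (vE _ _ ym) v1' mul1r.
move: v1 => [x /fraction_neq0_ex[a [b [a0 b0 ->]]]].
have [_ _ _ ord_ex] := Pt.
have [[i ai] [j bj]] := (ord_ex _ a0, ord_ex _ b0).
rewrite vM ?invr_eq0 ?tofrac_eq0 //.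
have : v b%:F + v (b%:F)^-1 = 0.
  rewrite -vM ?invr_eq0 ?tofrac_eq0 // mulfV ?tofrac_eq0 // -tofrac1 vu //; exact: prime1.
rewrite (vE _ _ ai) (vE _ _ bj) => E E1.
have : v t%:F * (i%:Z - j%:Z) = 1.
  by rewrite mulrBr; lia.
move=> /(congr1 absz)/eqP; rewrite abszM muln_eq1 => /andP[/eqP abs1 _].
by rewrite -(gez0_abs vt) abs1.
Qed.

End ValAt.

Lemma prime_divisor_height_one (P : prime_divisor R) : height_one P.
Proof. by case: P => P htP; apply/asboolP. Qed.

Lemma prime_divisor_prime (P : prime_divisor R) : prime_ideal P.
Proof. by case: (prime_divisor_height_one P). Qed.

Lemma prime_divisor_nonzero (P : prime_divisor R) : nonzero_ideal P.
Proof. by case: (prime_divisor_height_one P). Qed.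

Lemma prime_divisor_sub (P : set R) (Q : prime_divisor R) :
  prime_ideal P -> nonzero_ideal P -> (forall a, P a -> ideal_of Q a) -> P = Q.
Proof. by case: (prime_divisor_height_one Q) => _ _ minQ; apply: minQ. Qed.

Lemma prime_divisor_subP (P Q : prime_divisor R) :
  (forall a, ideal_of P a -> ideal_of Q a) -> P = Q.
Proof.
move=> PQ; apply: val_inj; apply: prime_divisor_sub => //.
  exact: prime_divisor_prime.
exact: prime_divisor_nonzero.
Qed.

End Uniformizers.

Section ClassGroupTheory.
Variable R : idomainType.
Local Open Scope quotient_scope.
Local Notation "x %:F" := (@tofrac R x).
Local Notation Cl := (class_group R).
Implicit Types (P Q : prime_divisor R) (D E : weil_divisor R).

Definition divisor_class D : Cl := \pi_Cl D.

Lemma divisor_classB : {morph divisor_class : D E / D - E}.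
Proof. by move=> D E; rewrite /divisor_class;
  exact: (raddfB \pi_({ideal_quot principal_divisors R})). Qed.

HB.instance Definition _ :=
    GRing.isZmodMorphism.Build (weil_divisor R) Cl divisor_class divisor_classB.

Lemma divisor_class_surj c : exists D, divisor_class D = c.
Proof. by exists (repr c); apply: reprK. Qed.

Lemma divisor_class_eq0 D : divisor_class D = 0 <-> exists2 x, x != 0 & is_div x D.
Proof.
have -> : (divisor_class D = 0) <-> principal D.
  rewrite -[X in principal X]subr0 -(raddf0 divisor_class).
  have -> : principal (D - 0) = (D == 0 %[mod {ideal_quot principal_divisors R}]).
    exact: (Quotient.idealrBE (principal_divisors R)).
  by split => [/eqP|/eqP].
by split => [/asboolP|?]; last apply/asboolP.
Qed.

Lemma weil_divisor_sum D : D = \sum_(P <- dom D) <<P>> *~ coeff P D.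
Proof.
by rewrite -[LHS]freeg_sumE; apply: eq_bigr => P _; rewrite freegU_mulz intz.
Qed.

Lemma coeff_prime P Q : coeff P (<<Q>> : weil_divisor R) = (Q == P)%:R.
Proof. by rewrite coeffU mul1r. Qed.

Section Valuations.
Hypothesis unif : forall P : prime_divisor R, exists t, uniformizer P t.

Lemma order_ex P y : y != 0 -> exists2 m : nat,
  val_at P y%:F = m%:Z & (ideal_of P y <-> (0 < m)%N).
Proof.
move=> y0; have [t Pt] := unif P; have [_ _ _ ord_ex] := Pt.
have [m ym] := ord_ex _ y0; exists m; first exact: val_at_order ym.
exact: has_order_gt0 ym.
Qed.

Lemma val_at_ge0 P y : y != 0 -> 0 <= val_at P y%:F.
Proof. by move=> /(order_ex P)[m -> _]. Qed.

Lemma val_at_eq0 P y : y != 0 -> val_at P y%:F = 0 <-> ~ ideal_of P y.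
Proof.
move=> /(order_ex P)[m -> H]; split=> [m0 /H|nPy]; first lia.
by case: m H => // m H; case: nPy; apply/H.
Qed.

Lemma is_div_class D y : y != 0 -> is_div y%:F D -> divisor_class D = 0.
Proof. by move=> y0 yD; apply/divisor_class_eq0; exists y%:F; rewrite ?tofrac_eq0. Qed.

(** The uniformizer has value 1 at [P] and no nonzero element of [P] has a smaller one. At another
    [Q] the minimum is 0, because height one primes are incomparable and some element of [P] avoids
    [Q]. *)
Lemma ideal_div_prime P : ideal_div P = <<P>>.
Proof.
have PP : is_ideal_div P (<<P>> : weil_divisor R).
  move=> Q; rewrite coeff_prime; have [->|neq_PQ] := eqVneq P Q; split.
  - have [t Qt] := unif Q; have [prQ Q_t t0 _] := Qt; exists t => //; split=> //.
    by apply: (val_at_order Qt); rewrite -{2}[t]expr1; apply: has_order_exp.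
  - by move=> f Qf f0; have [m -> H] := order_ex Q f0; have := H.1 Qf; lia.
  - have [f [Pf nQf]] : exists f, ideal_of P f /\ ~ ideal_of Q f.
      apply: contrapT => /forallNP PQ; case/eqP: neq_PQ; apply: prime_divisor_subP => a Pa.
      by apply: contrapT => nQa; apply: (PQ a).
    have f0 := prime_neq0 (prime_divisor_prime Q) nQf.
    by exists f => //; split=> //; apply/val_at_eq0.
  - by move=> f _ f0; apply: val_at_ge0.
rewrite /ideal_div; case: xgetP => [D _ DP|/(_ _ PP) //].
apply/eqP/freeg_eqP => Q.
have [[[f Pf [f0 vf]] lef] [[f' Pf' [f'0 vf']] lef']] := (DP Q, PP Q).
by apply/eqP; rewrite eq_le -{1}vf' lef // -vf lef'.
Qed.

End Valuations.

End ClassGroupTheory.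

(** * Primes without homogeneous elements *)

Section NonhomogeneousPrimes.
Variables (B : idomainType) (phi : {rmorphism B -> {poly B}}).
Hypothesis phiP : is_cograding phi.
Implicit Types (a b f s t y : B) (P Q : set B).
Local Notation homogeneous := (homogeneous phi).
Local Notation spread := (spread phi).
Local Notation divides_uth := (divides_up_to_homogeneous phi).
Local Notation "x %:F" := (@tofrac B x).

(** For a prime [P]: it survives in the localization at the nonzero homogeneous elements. *)
Definition homogeneous_free P := forall y, y != 0 -> homogeneous y -> ~ P y.

Lemma spread_homogeneousM s y : s != 0 -> homogeneous s -> y != 0 -> spread (s * y) = spread y.
Proof.
by move=> s0 hs y0; have := spreadM phiP s0 y0;
  rewrite (spread_homogeneous s0 hs) add1n => -[].
Qed.

Lemma spread_quotient f s q y : ~ homogeneous f -> y != 0 -> s != 0 -> homogeneous s ->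
  s * y = q * f -> q != 0 /\ (spread q < spread y)%N.
Proof.
move=> nhf y0 s0 hs E.
have : q * f != 0 by rewrite -E mulf_neq0.
rewrite mulf_eq0 negb_or => /andP[q0 f0]; split=> //.
have := spreadM phiP q0 f0; rewrite -E spread_homogeneousM //.
have := spread_gt0 phiP f0; case: (ltngtP (spread f) 1) => [||/(spread1_homogeneous phiP)//];
  lia.
Qed.

Lemma divides_uth0 f : divides_uth f 0.
Proof.
exists 1; split; [exact: oner_neq0|exact: homogeneous1|].
by rewrite mulr0; apply: divides0.
Qed.

Lemma divides_uthMl f a b : divides_uth f b -> divides_uth f (a * b).
Proof.
by move=> [s [s0 hs fb]]; exists s; split=> //; rewrite mulrCA; apply: dividesMl.
Qed.

Lemma divides_uthD f a b : divides_uth f a -> divides_uth f b -> divides_uth f (a + b).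
Proof.
move=> [s [s0 hs [u aE]]] [s' [s'0 hs' [v bE]]]; exists (s * s').
split; [exact: mulf_neq0|exact: homogeneousM|exists (s' * u + s * v)].
have -> : s * s' * (a + b) = s' * (s * a) + s * (s' * b) by ring.
by rewrite aE bE; ring.
Qed.

Lemma divides_uth_homogeneousM f s a : s != 0 -> homogeneous s ->
  divides_uth f (s * a) -> divides_uth f a.
Proof.
move=> s0 hs [s' [s'0 hs' fa]]; exists (s' * s).
by split; [exact: mulf_neq0|exact: homogeneousM|rewrite -mulrA].
Qed.

Lemma divides_uth_trans f g a : divides_uth f g -> divides_uth g a -> divides_uth f a.
Proof.
move=> [s [s0 hs [u gE]]] [s' [s'0 hs' [v aE]]].
apply: (divides_uth_homogeneousM s'0 hs'); rewrite aE; apply: divides_uthMl.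
by exists s; split => //; exists u.
Qed.

Lemma divides_uth_homogeneous f a : ~ homogeneous f -> a != 0 -> homogeneous a ->
  ~ divides_uth f a.
Proof.
move=> nhf a0 ha [s [s0 hs [u aE]]].
have [] := @homogeneous_factor _ _ phiP u f; rewrite -?aE ?mulf_neq0 //.
exact: homogeneousM.
Qed.

(** Let [f] generate [P] in the homogeneous localization. As [f] is not homogeneous, dividing by it
    lowers the spread, so the division stops at an element outside [P]. The homogeneous multipliers
    avoid [P] and are admissible in [has_order]. *)
Lemma homogeneous_free_uniformizer P : prime_ideal P -> nonzero_ideal P ->
  homogeneous_free P ->
  exists f, [/\ uniformizer P f, ~ homogeneous f & forall y, P y -> divides_uth f y].
Proof.
move=> prP nzP nhP.
have [|||f [Pf f0 fP]] := ideal_generator phiP (I := P); rewrite //.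
- by move=> a b; apply: primeB.
- by move=> a b; apply: primeMl.
have nhf : ~ homogeneous f by move=> /(nhP _ f0).
exists f; split=> //; split=> // y.
have [N] := ubnP (spread y); elim: N y => // N IH y; rewrite ltnS => leN y0.
have [/fP[s [s0 hs [q qE]]]|nPy] := pselect (P y); last first.
  by exists 0%N, 1, y; rewrite !mul1r; split=> //; apply: prime1.
have [q0 ltq] := spread_quotient nhf y0 s0 hs qE.
have [m [s' [u [nPs' nPu qE']]]] := IH _ (leq_trans ltq leN) q0.
exists m.+1, (s' * s), u; split=> //; first by apply: primeNM => //; apply: nhP.
by rewrite -mulrA qE mulrA qE' exprS; ring.
Qed.

(* Among the non-homogeneous [f] dividing a homogeneous multiple of [a], one of
   least spread generates a prime of the homogeneous localization. *)
Lemma homogeneous_free_prime_ex a : a != 0 -> ~ homogeneous a ->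
  exists P, [/\ prime_ideal P, P a & homogeneous_free P].
Proof.
move=> a0 nha.
have [|f [f0 nhf fa] min_f] := @ex_minimizer _
    (fun f => [/\ f != 0, ~ homogeneous f & divides_uth f a]) spread.
  exists a; split=> //; exists 1; split; [exact: oner_neq0|exact: homogeneous1|].
  by rewrite mul1r; apply: dividesxx.
pose P : set B := divides_uth f.
have nhP : homogeneous_free P by move=> y y0 hy; apply: divides_uth_homogeneous.
exists P; split=> //; apply/prime_idealP; split.
- exact: divides_uth0.
- by apply: nhP; [exact: oner_neq0|exact: homogeneous1].
- by move=> y y'; apply: divides_uthD.
- by move=> y y'; apply: divides_uthMl.
move=> y y' fyy'.
have [|||m [[u [v mE]] m0 mP]] := ideal_generator phiP (I :=
    fun x => exists u v, x = u * f + v * y).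
- by move=> _ _ [u [v ->]] [u' [v' ->]]; exists (u - u'), (v - v'); ring.
- by move=> w _ [u [v ->]]; exists (w * u), (w * v); ring.
- by exists f => //; exists 1, 0; ring.
have [|s [s0 hs [q qE]]] := mP f; first by exists 1, 0; ring.
have my : divides_uth m y by apply: mP; exists 0, 1; ring.
(* A homogeneous [m] is a unit of the localization, so 1 is a combination of [f] and [y] there, and
   multiplying by [y'] finishes. *)
have [hm|nhm] := pselect (homogeneous m).
  right; apply: (divides_uth_homogeneousM m0 hm).
  have -> : m * y' = u * y' * f + v * (y * y') by rewrite mE; ring.
  apply: divides_uthD; apply: divides_uthMl => //.
  exists 1; split; [exact: oner_neq0|exact: homogeneous1|].
  by rewrite mul1r; apply: dividesxx.
(* Otherwise [m] divides [f], hence [a], up to homogeneous factors. Minimality bounds the spread of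
   [f] by that of [m], so the quotient [q] is homogeneous and [f] is associated to [m]. *)
left; apply: divides_uth_trans my.
have mf : divides_uth m f by exists s; split => //; exists q.
have le_fm : (spread f <= spread m)%N.
  by apply: min_f; split => //; apply: divides_uth_trans fa.
have : q * m != 0 by rewrite -qE mulf_neq0.
rewrite mulf_eq0 negb_or => /andP[q0 _].
have hq : homogeneous q.
  apply: (spread1_homogeneous phiP).
  have := spreadM phiP q0 m0; rewrite -qE spread_homogeneousM //.
  by have := spread_gt0 phiP q0; lia.
apply: (divides_uth_homogeneousM q0 hq); rewrite -qE.
by exists 1; split; [exact: oner_neq0|exact: homogeneous1|exists s; rewrite mul1r].
Qed.

(** Choose a representation [a / b] of least total spread. If one of the two is not homogeneous, it
    lies in a homogeneous-free prime; as [x] has value 0 there, both lie in it, and cancelling the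
    generator [f] from both lowers the total spread. *)
Lemma fraction_homogeneous (x : {fraction B}) : x != 0 ->
    (forall P : prime_divisor B, homogeneous_free P -> val_at P x = 0) ->
  exists s t, [/\ s != 0, homogeneous s, t != 0, homogeneous t & x = s%:F / t%:F].
Proof.
move=> x0 vx.
have [|[a b] [/= a0 b0 xE] min_ab] := @ex_minimizer (B * B)
    (fun c => [/\ c.1 != 0, c.2 != 0 & x = c.1%:F / c.2%:F])
    (fun c => (spread c.1 + spread c.2)%N).
  by have [a [b ?]] := fraction_neq0_ex x0; exists (a, b).
have noP P : prime_ideal P -> homogeneous_free P -> ~ (P a \/ P b).
  move=> prP nhP Pab.
  have nzP : nonzero_ideal P by case: Pab => ?; [exists a|exists b].
  have [f [Pf nhf fP]] := homogeneous_free_uniformizer prP nzP nhP.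
  have htP : `[< height_one P >] by apply/asboolP/(uniformizer_height_one Pf).
  pose D := PrimeDivisor htP.
  have [_ _ f0 ord_ex] := Pf.
  have [[i ai] [j bj]] := (ord_ex _ a0, ord_ex _ b0).
  have := vx D nhP; rewrite xE.
  rewrite val_at_div ?tofrac_eq0 // (val_at_order (P := D) Pf ai) (val_at_order (P :=
      D) Pf bj) => ij.
  have [Pa Pb] : P a /\ P b.
    have ia := has_order_gt0 Pf ai; have jb := has_order_gt0 Pf bj.
    have {ij}ij : i = j by lia.
    by move: Pab; rewrite ia jb ij; case.
  have [s [s0 hs [q aE]]] := fP _ Pa; have [s' [s'0 hs' [q' bE]]] := fP _ Pb.
  have [q0 ltq] := spread_quotient nhf a0 s0 hs aE.
  have [q'0 ltq'] := spread_quotient nhf b0 s'0 hs' bE.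
  have := min_ab (s' * q, s * q'); rewrite /= !spread_homogeneousM // leqNgt.
  rewrite -addnS leq_add ?(ltnW ltq) // => /(_ _)/negP; apply; split; rewrite ?mulf_neq0 //.
  rewrite xE; apply/eqP; rewrite eqr_div ?tofrac_eq0 ?mulf_neq0 // -!tofracM tofrac_eq.
  apply/eqP/(mulfI f0).
  have -> : f * (a * (s * q')) = (s * a) * (q' * f) by ring.
  have -> : f * (s' * q * b) = (q * f) * (s' * b) by ring.
  by rewrite aE bE.
exists a, b; split=> //; apply: contrapT => nh.
  by have [P [prP Pa nhP]] := homogeneous_free_prime_ex a0 nh; case: (noP P prP nhP); left.
by have [P [prP Pb nhP]] := homogeneous_free_prime_ex b0 nh; case: (noP P prP nhP); right.
Qed.

End NonhomogeneousPrimes.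

(** * Groups generated by n-torsion elements *)

Section CyclicSum.
Variables (V : zmodType) (n m : nat) (b : 'I_m.+1 -> V).
Hypotheses (n_gt0 : (0 < n)%N)
  (b_span : forall x, exists a : 'I_m.+1 -> int, x = \sum_i b i *~ a i)
  (b_torsion : forall i, b i *+ n = 0)
  (b_sum : (1 < n)%N -> \sum_i b i = 0)
  (b_rel : forall a : 'I_m.+1 -> int, (1 < n)%N -> \sum_i b i *~ a i = 0 ->
     exists k : int, forall i, (n %| a i - k)%Z).

Let c (i : 'I_m) : V := b (widen_ord (leqnSn m) i).

(** The relation [\sum_i b i = 0] eliminates the last generator when [1 < n]; for [n = 1] torsion
    makes [V] trivial. *)
Lemma initial_span x : exists a : 'I_m -> int, x = \sum_i c i *~ a i.
Proof.
have [a ->] := b_span x; have [n_le1|n_gt1] := leqP n 1.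
  exists (fun=> 0); have n1 : n = 1%N by lia.
  have b0 i : b i = 0 by rewrite -[b i]mulr1n -n1 b_torsion.
  by rewrite !big1 // => i _; rewrite ?mulr0z // b0 mul0rz.
exists (fun i => a (widen_ord (leqnSn m) i) - a ord_max).
have := b_sum n_gt1; rewrite !big_ord_recr /= => /eqP; rewrite addrC addr_eq0 => /eqP ->.
rewrite mulNrz mulrz_suml -sumrB; apply: eq_bigr => i _; by rewrite mulrzBr.
Qed.

(** Extend [a] by 0 at the last index: the common residue [k] of [b_rel] is then 0 modulo [n]. *)
Lemma initial_relation (a : 'I_m -> int) : \sum_i c i *~ a i = 0 -> forall i, (n %| a i)%Z.
Proof.
have [n_le1 _ i|n_gt1 ac0 i] := leqP n 1.
  by have -> : n = 1%N by lia; rewrite dvd1z.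
pose a' (j : 'I_m.+1) := oapp a 0 (unlift ord_max j).
have a'_widen j : a' (widen_ord (leqnSn m) j) = a j.
  have -> : widen_ord (leqnSn m) j = fintype.lift ord_max j by apply: ord_inj;
    rewrite lift_max.
  by rewrite /a' liftK.
have a'_max : a' ord_max = 0 by rewrite /a' unlift_none.
have [|k kP] := b_rel (a := a') n_gt1.
  rewrite big_ord_recr /= a'_max mulr0z addr0 -[RHS]ac0.
  by apply: eq_bigr => j _; rewrite a'_widen.
have := kP ord_max; rewrite a'_max sub0r rpredN => nk.
by have := kP (widen_ord (leqnSn m) i); rewrite a'_widen => /rpredD/(_ nk); rewrite subrK.
Qed.

Lemma mulrn_modn (x : V) k : x *+ n = 0 -> x *+ (k %% n) = x *+ k.
Proof. by move=> xn; rewrite {2}(divn_eq k n) mulrnDr mulnC mulrnA xn mul0rn add0r. Qed.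

Let coord (a : {ffun 'I_m -> integers_mod n}) i : nat := (a i : 'I_n.-1.+1).

Let F (a : {ffun 'I_m -> integers_mod n}) : V := \sum_i c i *+ coord a i.

Let coordD a a' i : coord (a + a') i = ((coord a i + coord a' i) %% n)%N.
Proof.
have aE : (a + a') i = a i + a' i by rewrite ffunE.
by rewrite -[in RHS](prednK n_gt0); apply: (congr1 (@nat_of_ord _) aE).
Qed.

Let coord_lt a i : (coord a i < n)%N.
Proof. by rewrite -[X in (_ < X)%N](prednK n_gt0); apply: ltn_ord. Qed.

Let coord_eq0 a : (forall i, coord a i = 0%N) -> a = 0.
Proof. by move=> a0; apply/ffunP => i; rewrite ffunE; apply: ord_inj; apply: a0. Qed.

Let FD a a' : F (a + a') = F a + F a'.
Proof.
rewrite /F -big_split; apply: eq_bigr => i _ /=.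
by rewrite coordD mulrn_modn ?mulrnDr // /c b_torsion.
Qed.

Let FB a a' : F (a - a') = F a - F a'.
Proof. by apply: (addIr (F a')); rewrite -FD !subrK. Qed.

Let F_inj : injective F.
Proof.
move=> a a' aa'; apply/eqP; rewrite -subr_eq0; apply/eqP/coord_eq0 => i.
have : F (a - a') = 0 by rewrite FB aa' subrr.
move: (a - a') => d; rewrite /F (eq_bigr (fun i => c i *~ (coord d i)%:Z)) => [|j _];
  last by rewrite -pmulrn.
move=> /initial_relation/(_ i); rewrite dvdzE /= => nd.
by apply/eqP; rewrite -leqn0 leqNgt; apply: contraTN (coord_lt d i) => /dvdn_leq/(_ nd);
  rewrite leqNgt.
Qed.

Let F_surj x : exists a, F a = x.
Proof.
have [a ->] := initial_span x.
exists [ffun i => inord `|(a i %% n)%Z|%N]; apply: eq_bigr => i _; rewrite /coord ffunE.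
have n0 : n%:Z != 0 by rewrite gt_eqF.
have an : (0 <= a i %% n)%Z by rewrite modz_ge0.
rewrite inordK ?prednK //; last by rewrite -ltz_nat gez0_abs // ltz_pmod.
rewrite pmulrn gez0_abs // /modz mulrzBr mulrC mulrzA.
by rewrite -pmulrn b_torsion mul0rz subr0.
Qed.

Lemma cyclic_sum_iso : isomorphic_groups V {ffun 'I_m -> integers_mod n}.
Proof.
have [f fK] : exists f : V -> {ffun 'I_m -> integers_mod n}, cancel f F.
  by exists (fun x => projT1 (cid (F_surj x))) => x; case: cid.
have fB : {morph f : x y / x - y} by move=> x y; apply: F_inj; rewrite FB !fK.
pose f' : {additive V -> {ffun 'I_m -> integers_mod n}} :=
  HB.pack f (GRing.isZmodMorphism.Build _ _ f fB).
exists f', F => // a; apply: F_inj; exact: fK.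
Qed.

Lemma cyclic_sum_generates : generates c [set: 'I_m]%SET.
Proof.
move=> x; have [a ->] := initial_span x; exists a.
by apply: eq_bigl => i; rewrite finset.in_setT.
Qed.

Lemma cyclic_sum_minimally_generates : (1 < n)%N -> minimally_generates c.
Proof.
move=> n_gt1; split=> [|J /properP[_ [i _ iJ]] genJ]; first exact: cyclic_sum_generates.
have [a ciE] := genJ (c i).
(* Expressing [c i] through the indices in [J], which omits [i], yields a relation with coefficient
   -1 at [i], so [n] would divide 1. *)
have /(_ i) : forall j, (n %| (if j \in J then a j else 0) - (j == i)%:Z)%Z.
  apply: initial_relation; under eq_bigr do rewrite mulrzBr.
  rewrite sumrB [X in _ - X](bigD1 i) //= eqxx mulr1z [X in _ - (_ + X)]big1 => [|j /negbTE
      ->]; last first.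
    exact: mulr0z.
  rewrite addr0 ciE [X in _ - X]big_mkcond /=; apply/eqP; rewrite subr_eq0; apply/eqP.
  by apply: eq_bigr => j _; case: ifP; rewrite ?mulr0z.
by rewrite (negbTE iJ) eqxx sub0r rpredN dvdz1 /= => /eqP n1; rewrite n1 in n_gt1.
Qed.

End CyclicSum.

(** * The hypersurface *)

Section Hypersurface.
Variables (A R : idomainType) (n e : nat) (g : A) (pi : {rmorphism {poly A} -> R}).
Hypotheses (n_gt0 : (0 < n)%N) (e_n : coprime e n).
Hypothesis pi_surj : forall y : R, exists p, pi p = y.
Hypothesis pi_ker : forall p, pi p = 0 <-> exists q, p = q * ('X^n - g%:P).
Local Notation z := (pi 'X).
Local Notation "''i' a" := (pi a%:P) (at level 9, a at level 8).
Local Notation modulus := ('X^n - g%:P : {poly A}).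

Implicit Types (p q r s : {poly A}) (a b : A) (x y : R).

Lemma monic_modulus : modulus \is monic.
Proof. exact: monicXnsubC. Qed.

Lemma size_modulus : size modulus = n.+1.
Proof. exact: size_XnsubC. Qed.

Lemma pi_zn : z ^+ n = 'i g.
Proof.
apply/eqP; rewrite -rmorphXn -subr_eq0 -rmorphB /=; apply/eqP/pi_ker.
by exists 1; rewrite mul1r.
Qed.

Lemma pi_sum p : pi p = \sum_(j < size p) 'i p`_j * z ^+ j.
Proof.
rewrite -[p in LHS]coefK poly_def rmorph_sum /=; apply: eq_bigr => j _.
by rewrite -mul_polyC rmorphM /= rmorphXn.
Qed.

(** With [reduced_inj] below, this says that [R] is a free [A]-module on the powers of [z] of
    exponent less than [n]. *)
Lemma reduced_ex y : exists r, (size r <= n)%N /\ pi r = y.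
Proof.
have [p <-] := pi_surj y; exists (Pdiv.Ring.rmodp p modulus); split.
  by rewrite -ltnS -size_modulus Pdiv.Ring.ltn_rmodp monic_neq0 // monic_modulus.
rewrite {2}(Pdiv.RingMonic.rdivp_eq monic_modulus p) rmorphD -[LHS]add0r; congr (_ + _).
by symmetry; apply/pi_ker; exists (Pdiv.Ring.rdivp p modulus).
Qed.

Lemma reduced_eq0 r : (size r <= n)%N -> pi r = 0 -> r = 0.
Proof.
move=> szr /pi_ker[q rE]; have [q0|q0] := eqVneq q 0; first by rewrite rE q0 mul0r.
move: szr; rewrite rE size_Mmonic ?monic_modulus // size_modulus addnS /=.
rewrite -[X in (_ <= X)%N -> _]add0n leq_add2r leqn0 size_poly_eq0.
by rewrite (negbTE q0).
Qed.

Lemma reduced_inj r s : (size r <= n)%N -> (size s <= n)%N -> pi r = pi s -> r = s.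
Proof.
move=> szr szs rs; apply/eqP; rewrite -subr_eq0; apply/eqP/reduced_eq0.
  by rewrite (leq_trans (size_polyD _ _)) // size_polyN geq_max szr.
by rewrite rmorphB rs subrr.
Qed.

Lemma piC_inj a b : 'i a = 'i b -> a = b.
Proof.
by move=> /reduced_inj/polyC_inj -> //; rewrite (leq_trans (size_polyC_leq1 _)).
Qed.

Lemma piC_eq0 a : ('i a == 0) = (a == 0).
Proof. by apply/eqP/eqP => [|->]; rewrite -?(rmorph0 pi) // -polyC0 => /piC_inj. Qed.

Lemma divides_pi a r : (size r <= n)%N -> divides 'i a (pi r) -> divides a%:P r.
Proof.
move=> szr [y]; have [s [szs <-]] := reduced_ex y.
rewrite -rmorphM => /reduced_inj -> //; first by exists s.
by rewrite mulrC mul_polyC (leq_trans (size_scale_leq _ _)).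
Qed.

(** * The grading of R *)

Variable phiA : {rmorphism A -> {poly A}}.
Hypotheses (phiAP : is_cograding phiA) (g_hom : phiA g = g *: 'X^e).

(** Substituting ['X^n] for ['X] multiplies the degrees of [A] by [n]. *)
Definition coef_cograding : {rmorphism A -> {poly R}} :=
  comp_poly 'X^n \o map_poly (pi \o polyC) \o phiA.

Definition poly_cograding : {rmorphism {poly A} -> {poly R}} :=
  horner_morph (fun a => mulrC (z *: 'X^e) (coef_cograding a)).

Lemma poly_cogradingC a : poly_cograding a%:P = coef_cograding a.
Proof. exact: horner_morphC. Qed.

Lemma poly_cogradingX : poly_cograding 'X = z *: 'X^e.
Proof. exact: horner_morphX. Qed.

Lemma coef_cograding_homogeneous a i : phiA a = a *: 'X^i ->
  coef_cograding a = 'i a *: 'X^(n * i).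
Proof.
move=> aE; rewrite /coef_cograding /= aE map_polyZ /= map_polyXn.
by rewrite comp_polyZ comp_Xn_poly -exprM.
Qed.

Lemma coef_coef_cograding a m :
  (coef_cograding a)`_m = if (n %| m)%N then 'i (phiA a)`_(m %/ n) else 0.
Proof.
by rewrite /coef_cograding /= coef_comp_poly_Xn // coef_map.
Qed.

Lemma poly_cograding_sum p :
  poly_cograding p = \sum_(j < size p) coef_cograding p`_j * (z ^+ j *: 'X^(e * j)).
Proof.
rewrite -[p in LHS]coefK poly_def rmorph_sum; apply: eq_bigr => j _.
rewrite -mul_polyC rmorphM rmorphXn poly_cogradingC poly_cogradingX.
by rewrite exprZn -exprM.
Qed.

(** Both [z ^+ n] and the image of [g] get degree [n * e]; this is what lets the grading descend to
    [R]. *)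
Lemma poly_cograding_modulus : poly_cograding modulus = 0.
Proof.
rewrite rmorphB rmorphXn poly_cogradingC poly_cogradingX.
by rewrite (coef_cograding_homogeneous g_hom) exprZn -exprM pi_zn mulnC subrr.
Qed.

Lemma poly_cograding_ker p : pi p = 0 -> poly_cograding p = 0.
Proof. by move=> /pi_ker[q ->]; rewrite rmorphM poly_cograding_modulus mulr0. Qed.

Lemma poly_cograding_horner1 p : (poly_cograding p).[1] = pi p.
Proof.
rewrite poly_cograding_sum [RHS]pi_sum horner_sum; apply: eq_bigr => j _.
rewrite hornerM hornerZ hornerXn expr1n mulr1; congr (_ * _).
rewrite /coef_cograding /= horner_comp hornerXn expr1n.
have -> : 1 = (pi \o polyC) 1 by rewrite rmorph1.
by rewrite horner_map /= phiAP.1.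
Qed.

(* As [e] is prime to [n], a degree [D] determines the exponent [j < n] of [z]
   in a homogeneous element. *)
Lemma poly_cograding_coef p D : (size p <= n)%N ->
  exists a i j, [/\ (j < n)%N, phiA a = a *: 'X^i,
    (poly_cograding p)`_D = 'i a * z ^+ j & a != 0 -> (n * i + e * j = D)%N].
Proof.
move=> szp.
(* The term in [z ^+ j] can contribute to degree [D] only if [D - e * j] is a nonnegative multiple
   of [n]. *)
pose ok (j : nat) := (e * j <= D)%N && (n %| D - e * j)%N.
have termE j : (coef_cograding p`_j * (z ^+ j *: 'X^(e * j)))`_D =
    if ok j then 'i (phiA p`_j)`_((D - e * j) %/ n) * z ^+ j else 0.
  rewrite -scalerAr coefZ coefMXn /ok ltnNge coef_coef_cograding.
  by case: leqP => //= _; rewrite ?mulr0 //; case: ifP => _; rewrite ?mulr0 // mulrC.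
have ok_inj i j : (i < n)%N -> (j < n)%N -> ok i -> ok j -> i = j.
  move=> lti ltj /andP[le_i /dvdnP[u uE]] /andP[le_j /dvdnP[v vE]].
  wlog le_ij : i j u v lti ltj le_i uE le_j vE / (i <= j)%N.
    by move=> W; case/orP: (leq_total i j) => le; [|symmetry]; apply: W le; eassumption.
  have : (n %| e * (j - i))%N.
    rewrite mulnBr -(_ : (u - v) * n = e * j - e * i)%N ?dvdn_mull // mulnBl -uE -vE; lia.
  rewrite Gauss_dvdr 1?coprime_sym // => /dvdnP[[|w] E]; lia.
rewrite poly_cograding_sum coef_sum.
have [[j [ltj okj]]|no] := pselect (exists j, (j < size p)%N /\ ok j); last first.
  exists 0, 0%N, 0%N; split; rewrite ?rmorph0 ?scale0r ?mul0r ?eqxx //.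
  rewrite big1 // => j _; rewrite termE; case: ifP => // okj; case: no; by exists j.
exists (phiA p`_j)`_((D - e * j) %/ n), ((D - e * j) %/ n)%N, j; split.
- exact: leq_trans ltj szp.
- exact: phiAP.2.
- rewrite (bigD1 (Ordinal ltj)) //= termE okj big1 ?addr0 // => i.
  rewrite -val_eqE /= termE; case: ifP => // oki /eqP[]; apply: ok_inj => //.
    exact: leq_trans (ltn_ord i) szp.
  exact: leq_trans ltj szp.
- by move=> _; case/andP: okj => le_j /divnK E; rewrite (mulnC n) E subnK.
Qed.

(** [poly_cograding] kills the kernel of [pi], so it may be computed on any representative; reduced
    ones give the form of the homogeneous elements, with exponent of [z] below [n]. *)
Lemma hypersurface_cograding : exists phi : {rmorphism R -> {poly R}},
  [/\ is_cograding phi,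
      forall a i, phiA a = a *: 'X^i -> phi 'i a = 'i a *: 'X^(n * i)
    & forall y, homogeneous phi y ->
        exists a j, [/\ (j < n)%N, homogeneous phiA a & y = 'i a * z ^+ j]].
Proof.
have [rep repE] : exists rep, forall y, pi (rep y) = y /\ (size (rep y) <= n)%N.
  by exists (fun y => projT1 (cid (reduced_ex y))) => y; case: cid => r [].
pose f y := poly_cograding (rep y).
have fE p y : pi p = y -> f y = poly_cograding p.
  move=> pE; apply/eqP; rewrite -subr_eq0 -rmorphB; apply/eqP/poly_cograding_ker.
  by rewrite rmorphB (repE y).1 pE subrr.
have [||| phi phiE] := @rmorphism_ex R {poly R} f.
- by move=> x y; rewrite -rmorphB; apply: fE; rewrite rmorphB !(repE _).1.
- by rewrite -(rmorph1 poly_cograding); apply: fE; rewrite rmorph1.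
- by move=> x y; rewrite -rmorphM; apply: fE; rewrite rmorphM !(repE _).1.
have phi_pi p : phi (pi p) = poly_cograding p by rewrite phiE; apply: fE.
have phi_hom a i j : phiA a = a *: 'X^i ->
    phi ('i a * z ^+ j) = ('i a * z ^+ j) *: 'X^(n * i + e * j).
  move=> aE; rewrite -rmorphXn -rmorphM phi_pi (rmorphM poly_cograding) (rmorphXn
      poly_cograding) poly_cogradingC poly_cogradingX.
  by rewrite (coef_cograding_homogeneous aE) exprZn -exprM -scalerAl -scalerAr scalerA -exprD
      rmorphM rmorphXn.
have phiP : is_cograding phi.
  split=> y; first by rewrite phiE poly_cograding_horner1 (repE y).1.
  move=> D; have -> : phi y = poly_cograding (rep y) by rewrite phiE.
  have [a [i [j [_ aE -> DE]]]] := poly_cograding_coef D (repE y).2.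
  rewrite (phi_hom _ _ _ aE); have [->|/DE -> //] := eqVneq a 0.
  by rewrite rmorph0 mul0r !scale0r.
exists phi; split=> //.
  by move=> a i aE; have := phi_hom a i 0%N aE; rewrite expr0 mulr1 muln0 addn0.
move=> y [D yE].
have [a [i [j [ltj aE jE _]]]] := poly_cograding_coef D (repE y).2.
exists a, j; split=> //; first by exists i.
rewrite -jE; have <- : phi y = poly_cograding (rep y) by rewrite phiE.
by rewrite yE coefZ coefXn eqxx mulr1.
Qed.

Variable phi : {rmorphism R -> {poly R}}.
Hypotheses (phiP : is_cograding phi)
  (phiC : forall a i, phiA a = a *: 'X^i -> phi 'i a = 'i a *: 'X^(n * i))
  (phi_hom : forall y, homogeneous phi y ->
     exists a j, [/\ (j < n)%N, homogeneous phiA a & y = 'i a * z ^+ j]).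
Hypotheses (fA : factorial A)
  (degree0_unit : forall a, a != 0 -> phiA a = a *: 'X^0 -> a \is a GRing.unit).

(** * Homogeneous primes of A that stay prime in R *)

Section HomogeneousPrime.
Variable p : A.
Hypotheses (p_irr : irreducible_element p) (p_hom : homogeneous phiA p)
  (p_g : n = 1%N \/ ~ divides p g).

Definition principal_ideal : set R := divides 'i p.

Let p0 : p != 0. Proof. by case: p_irr. Qed.
Let p_prime : prime_element p. Proof. exact: fA.2. Qed.
Let ip0 : 'i p != 0. Proof. by rewrite piC_eq0. Qed.

Let divides_homogeneous a j : (j < n)%N -> divides 'i p ('i a * z ^+ j) -> divides p a.
Proof.
move=> ltj; have -> : 'i a * z ^+ j = pi (a *: 'X^j) by rewrite -mul_polyC rmorphM rmorphXn.
have szj : (size (a *: 'X^j) <= n)%N.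
  by rewrite (leq_trans (size_scale_leq _ _)) // size_polyXn.
move=> /(divides_pi szj)/divides_polyC/(_ j).
by rewrite coefZ coefXn eqxx mulr1.
Qed.

Lemma principal_ideal_phi y k : principal_ideal y -> principal_ideal (phi y)`_k.
Proof.
have [i pE] := p_hom; move=> [w ->]; rewrite rmorphM (phiC pE) -scalerAr coefZ mulrC.
by eexists.
Qed.

(** Since [p] is homogeneous, divisibility by it can be tested on homogeneous components. These have
    the form [a z^j], so a product of two is reduced with [z ^+ n = g] and primeness of [p] in [A]
    applies. *)
Lemma principal_ideal_prime : prime_ideal principal_ideal.
Proof.
apply/prime_idealP; split.
- exact: divides0.
- rewrite /principal_ideal -(rmorph1 pi) => p1.
  have /divides_polyC/(_ 0%N) : divides p%:P 1 by apply: divides_pi => //; rewrite size_poly1.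
  rewrite coef1 /= => /(divides_unit (unitr1 _)).
  by case: p_irr => _ /negbTE ->.
- exact: dividesD.
- by move=> a b; apply: dividesMl.
move=> y y' yy'.
have sum1 x : (forall k, divides 'i p (phi x)`_k) -> divides 'i p x.
  move=> px; rewrite -(phiP.1 x) horner_coef; apply: divides_sum => k _.
  exact: dividesMr.
have [|||] := @prime_coef_mul _ 'i p (phi y) (phi y'); [| |by move=> /sum1;
  left|by move=> /sum1; right].
  move=> i j.
  have [a [l [ltl _ ->]]] := phi_hom (homogeneous_coef phiP y i).
  have [a' [l' [ltl' _ ->]]] := phi_hom (homogeneous_coef phiP y' j).
  have E : 'i a * z ^+ l * ('i a' * z ^+ l') = 'i (a * a') * z ^+ (l + l').
    by rewrite polyCM rmorphM exprD; ring.
  suff dvd_aa' : divides 'i p ('i a * z ^+ l * ('i a' * z ^+ l')) -> divides p (a * a').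
    by move=> /dvd_aa'/p_prime[] /(divides_rmorph polyC)/(divides_rmorph pi) pa;
      [left|right]; apply: dividesMr.
  (* When the exponent reaches [n], reduction brings in a factor [g], which [p] does not divide. For
     [n = 1] this cannot happen, as both exponents are 0. *)
  rewrite E; have [ltn|len] := ltnP (l + l') n; first exact: divides_homogeneous.
  rewrite -(subnK len) exprD pi_zn // mulrCA -rmorphM -polyCM [_ * 'i _]mulrC =>
      /divides_homogeneous.
  case=> [|w]; first lia.
  case: p_g => [n1|npg]; first lia.
  move=> E'; have /p_prime[|//] : divides p (a * a' * g) by exists w.
  by [].
by move=> k; rewrite -rmorphM; apply: principal_ideal_phi.
Qed.

(** A homogeneous nonunit [p] has positive degree, so each division by [p] lowers the top degree and
    only finitely many are possible. *)
Lemma principal_ideal_uniformizer : uniformizer principal_ideal 'i p.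
Proof.
split => //; [exact: principal_ideal_prime|exact: dividesxx|move=> y].
have [N] := ubnP (size (phi y)); elim: N y => // N IH y; rewrite ltnS => leN y0.
have [[w yE]|npy] := pselect (principal_ideal y); last first.
  by exists 0%N; apply: has_order_notin => //; exact: principal_ideal_prime.
have w0 : w != 0 by apply: contraNneq y0 => w0; rewrite yE w0 mul0r.
have [i pE] := p_hom.
have i_gt0 : (0 < i)%N.
  rewrite lt0n; apply/eqP => i0; case: p_irr => _ /negP[].
  by apply: degree0_unit; rewrite // {1}pE i0.
have [|m wm] := IH w _ w0.
  apply: leq_trans leN; rewrite yE rmorphM (phiC pE) -scalerAr size_scale //.
  rewrite size_mulXn ?cograding_eq0 // -[X in (X < _)%N]add0n ltn_add2r muln_gt0 n_gt0.
  exact: i_gt0.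
exists (m + 1)%N; rewrite yE; apply: has_orderM => //; first exact: principal_ideal_prime.
rewrite -{2}['i p]expr1; apply: has_order_exp; exact: principal_ideal_prime.
Qed.

End HomogeneousPrime.

(** * The primes P_i *)

Variables (r : nat) (h : 'I_r.+1 -> A).
Hypotheses (h_irr : forall i, irreducible_element (h i)) (g_fact : g = \prod_(i < r.+1) h i).
Hypothesis R_normal : integrally_closed R.
Local Notation cofactor i := (\prod_(j < r.+1 | j != i) h j).

Lemma factor_cofactor i : g = h i * cofactor i.
Proof. by rewrite g_fact (bigD1 i). Qed.

Lemma h_prime i : prime_element (h i).
Proof. exact: (fA.2 _ (h_irr i)). Qed.

Lemma h_neq0 i : h i != 0.
Proof. by case: (h_irr i). Qed.

Lemma h_nonunit i : h i \isn't a GRing.unit.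
Proof. by case: (h_irr i). Qed.

Lemma g_neq0 : g != 0.
Proof. by rewrite g_fact; apply/prodf_neq0 => i _; apply: h_neq0. Qed.

(* If [h i ^+ 2] divided [g], then [z ^+ n.-1 / h i] would be integral over [R]. *)
Lemma cofactor_coprime i : (1 < n)%N -> ~ divides (h i) (cofactor i).
Proof.
move=> n_gt1 [w wE].
have gE : g = w * h i ^+ 2 by rewrite (factor_cofactor i) wE expr2; ring.
pose x : {fraction R} := tofrac (z ^+ n.-1) / tofrac 'i (h i).
have h0 : tofrac 'i (h i) != 0 by rewrite tofrac_eq0 piC_eq0 h_neq0.
have [|a xE] := R_normal (x := x).
  (* With [g = w h^2], the n-th power of [x] is [g^(n-1) / h^n = w^(n-1) h^(n-2)], where the last
     exponent is [2 (n - 1) - n]. *)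
  pose c := w ^+ n.-1 * h i ^+ n.-2.
  exists ('X^n - ('i c)%:P); first exact: monicXnsubC.
  rewrite rmorphB /= map_polyXn map_polyC /= /root hornerD hornerN hornerXn hornerC subr_eq0.
  rewrite /x expr_div_n; apply/eqP/(mulIf (expf_neq0 n h0)); rewrite mulfVK ?expf_neq0 //.
  rewrite -!tofracXn -tofracM; congr tofrac.
  rewrite -exprM mulnC exprM pi_zn // -!rmorphXn -rmorphM -polyCM; congr (pi _%:P).
  rewrite gE exprMn /c -exprM -mulrA -exprD; congr (_ * _ ^+ _); lia.
have : z ^+ n.-1 = a * 'i (h i).
  apply/eqP; rewrite -tofrac_eq tofracM -xE; apply/eqP.
  by rewrite /x mulfVK.
move=> zE.
(* As [z ^+ n.-1] belongs to the basis of [R] over [A], the nonunit [h i] would divide 1. *)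
have /divides_polyC/(_ n.-1) : divides (h i)%:P ('X^(n.-1) : {poly A}).
  apply: divides_pi; first by rewrite size_polyXn prednK.
  by exists a; rewrite rmorphXn.
rewrite coefXn eqxx => /(divides_unit (unitr1 _)).
by rewrite (negbTE (h_nonunit i)).
Qed.

Definition branch_ideal i : set R := ideal2 z 'i (h i).

(** Killing [z] turns [R] into [A / (g)], and [h i] divides [g]; hence [R / (z, h_i) = A / (h_i)],
    and membership is read off the constant term. *)
Lemma branch_idealE i p : branch_ideal i (pi p) <-> divides (h i) p`_0.
Proof.
split=> [[u [v]]|[w p0E]].
  have [[q <-] [q' <-]] := (pi_surj u, pi_surj v).
  rewrite -!rmorphM -rmorphD => /eqP;
    rewrite -subr_eq0 -rmorphB => /eqP/pi_ker[s /(congr1 (coefp 0))].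
  rewrite /= coefB coefD coefMX coefMC add0r coef0M coefB coefXn coefC eqxx /= ltn_eqF //
      sub0r => E.
  exists (q'`_0 - s`_0 * cofactor i);
    rewrite mulrBl -mulrA [_ * h i in X in _ - X]mulrC -factor_cofactor.
  by rewrite -[LHS](subrK (q'`_0 * h i)) E; ring.
have /factor_theorem[q qE] : root (p - (p`_0)%:P) 0.
  by rewrite /root hornerD hornerN hornerC horner_coef0 subrr.
exists (pi q), ('i w); rewrite -[p in LHS](subrK (p`_0)%:P) qE subr0 rmorphD rmorphM;
  congr (_ + _).
by rewrite {1}p0E polyCM rmorphM.
Qed.

Lemma branch_idealC i a : branch_ideal i 'i a <-> divides (h i) a.
Proof. by rewrite branch_idealE coefC eqxx. Qed.

Lemma branch_ideal_z i : branch_ideal i z.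
Proof. by apply/branch_idealE; rewrite coefX; apply: divides0. Qed.

Lemma branch_ideal_prime i : prime_ideal (branch_ideal i).
Proof.
apply/prime_idealP; split.
- by rewrite -(rmorph0 pi); apply/branch_idealE; rewrite coef0; apply: divides0.
- rewrite -(rmorph1 pi) => /branch_idealE; rewrite coef1 => /(divides_unit (unitr1 _)).
  by rewrite (negbTE (h_nonunit i)).
- move=> a b; have [[p <-] [q <-]] := (pi_surj a, pi_surj b).
  by rewrite -rmorphD !branch_idealE coefD; apply: dividesD.
- move=> a b; have [[p <-] [q <-]] := (pi_surj a, pi_surj b).
  by rewrite -rmorphM !branch_idealE coef0M; apply: dividesMl.
- move=> a b; have [[p <-] [q <-]] := (pi_surj a, pi_surj b).
  by rewrite -rmorphM !branch_idealE coef0M; apply: h_prime.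
Qed.

Lemma z_neq0 : z != 0.
Proof.
by apply: contraNneq g_neq0 => z0; rewrite -piC_eq0 -pi_zn // z0 expr0n gtn_eqF.
Qed.

Section Ramified.
Variable i : 'I_r.+1.
Hypothesis n_gt1 : (1 < n)%N.
Let prP := branch_ideal_prime i.

Let cofactor_notin m : ~ branch_ideal i ('i (cofactor i) ^+ m).
Proof. by move=> /(primeX prP)/branch_idealC; apply: cofactor_coprime. Qed.

(** Multiplied by its cofactor, which lies outside the prime, [h i] becomes [z ^+ n]. So the order
    is [n] times the multiplicity of [h i] in [a]. *)
Lemma branch_orderC a : a != 0 -> exists m, has_order (branch_ideal i) z 'i a (n * m).
Proof.
move=> a0; have [[mu muP] _] := fA.
have [m [b [aE nb]]] := multiplicity_length muP (h_nonunit i) a0.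
exists m, ('i (cofactor i) ^+ m), ('i b); split=> //; first by move/branch_idealC.
rewrite aE exprM pi_zn // (factor_cofactor i) !polyCM !rmorphM /= !rmorphXn /= exprMn; ring.
Qed.

(* The orders [n k + j] of the nonzero terms are distinct modulo [n]. *)
Lemma branch_order_sum (a : nat -> A) l : (l <= n)%N ->
  let y := \sum_(j < l) 'i (a j) * z ^+ j in
  y = 0 \/ exists2 m, has_order (branch_ideal i) z y m & (m %% n < l)%N.
Proof.
elim: l => [|l IH] ltl /=; first by left; rewrite big_ord0.
rewrite big_ord_recr /=; have [al0|al0] := eqVneq (a l) 0.
  rewrite al0 rmorph0 mul0r addr0; case: (IH (ltnW ltl)) => [|[m ym ltm]]; first by left.
  by right; exists m => //; apply: ltnW.
have [k ak] := branch_orderC al0.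
have {ak} alk : has_order (branch_ideal i) z ('i (a l) * z ^+ l) (n * k + l).
  by apply: has_orderM => //; apply: has_order_exp.
have kl : ((n * k + l) %% n = l)%N by rewrite mulnC modnMDl modn_small.
case: (IH (ltnW ltl)) => [->|[m ym ltm]]; first by right; rewrite add0r; exists (n * k + l)%N;
  rewrite ?kl.
have Pz := branch_ideal_z i.
right; have [lt|lt|eqm] := ltngtP m (n * k + l)%N.
- by exists m; [apply: (has_orderD_lt prP Pz ym alk)|apply: ltnW].
- by exists (n * k + l)%N; [rewrite addrC; apply: (has_orderD_lt prP Pz alk ym)|rewrite kl].
- by move: ltm; rewrite eqm kl ltnn.
Qed.

Lemma branch_uniformizer : uniformizer (branch_ideal i) z.
Proof.
split; [exact: prP|exact: branch_ideal_z|exact: z_neq0|move=> y y0].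
have [q [szq qE]] := reduced_ex y.
have := branch_order_sum (fun j => q`_j) szq; rewrite /= -pi_sum qE => -[y0'|[m ym _]].
  by rewrite y0' eqxx in y0.
by exists m.
Qed.

Lemma branch_order_h : has_order (branch_ideal i) z 'i (h i) n.
Proof.
exists ('i (cofactor i)), 1; split; first by rewrite -[X in branch_ideal i X]expr1.
  exact: prime1.
by rewrite mulr1 pi_zn // (factor_cofactor i) mulrC -rmorphM -polyCM.
Qed.

End Ramified.

Lemma h_homogeneous i : homogeneous phiA (h i).
Proof.
have [] := @homogeneous_factor _ _ phiAP (h i) (cofactor i);
  rewrite -?factor_cofactor ?g_neq0 //.
by exists e.
Qed.

Lemma branch_ideal_unramified i : n = 1%N -> branch_ideal i = principal_ideal (h i).
Proof.
move=> n1; apply/seteqP; split=> [y [u [v ->]]|y [w ->]].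
  apply: dividesD; apply: dividesMl; last exact: dividesxx.
  rewrite -[X in divides _ X]expr1 -n1 pi_zn // (factor_cofactor i).
  by exists ('i (cofactor i)); rewrite mulrC -rmorphM -polyCM.
by apply: primeMl; [exact: branch_ideal_prime|apply/branch_idealC/dividesxx].
Qed.

(* For [n = 1], [g] need not be square-free and [t] cannot always be [z]. *)
Lemma branch_uniformizer_ex i : exists t,
  uniformizer (branch_ideal i) t /\ has_order (branch_ideal i) t 'i (h i) n.
Proof.
have [n_le1|n_gt1] := leqP n 1; last first.
  by exists z; split; [apply: branch_uniformizer|apply: branch_order_h].
have n1 : n = 1%N by lia.
exists ('i (h i)); rewrite branch_ideal_unramified //.
have P_unif := principal_ideal_uniformizer (h_irr i) (h_homogeneous i) (or_introl n1).
split=> //; rewrite n1 -{2}['i _]expr1; apply: has_order_exp.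
by have [] := P_unif.
Qed.

Lemma branch_height_one i : `[< height_one (branch_ideal i) >].
Proof.
by apply/asboolP; have [t [/uniformizer_height_one]] := branch_uniformizer_ex i.
Qed.

Definition branch_divisor i : prime_divisor R := PrimeDivisor (branch_height_one i).

Lemma branch_divisor_sub i (P : prime_divisor R) : ideal_of P z -> ideal_of P 'i (h i) ->
  P = branch_divisor i.
Proof.
move=> Pz Ph; have prP := prime_divisor_prime P; symmetry; apply: prime_divisor_subP.
by move=> _ [u [v ->]]; apply: primeD => //; apply: primeMl.
Qed.

Lemma prime_divisor_z (P : prime_divisor R) : ideal_of P z -> exists i, P = branch_divisor i.
Proof.
move=> Pz; have prP := prime_divisor_prime P.
suff [i Ph] : exists i, ideal_of P 'i (h i) by exists i; apply: branch_divisor_sub.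
have : ideal_of P 'i g by rewrite -pi_zn // -(prednK n_gt0) exprS; apply: primeMr.
rewrite g_fact; elim/big_rec: _ => [|i a _ IH];
  first by rewrite polyC1 rmorph1 => /(prime1 prP).
by rewrite polyCM rmorphM => /(primeM prP)[Ph|//]; exists i.
Qed.

Lemma prime_divisor_h (P : prime_divisor R) i : ideal_of P 'i (h i) -> P = branch_divisor i.
Proof.
move=> Ph; apply: branch_divisor_sub => //; have prP := prime_divisor_prime P.
apply: (@primeX _ _ prP _ n); rewrite pi_zn // (factor_cofactor i) polyCM rmorphM.
exact: primeMr.
Qed.

(** A nonzero homogeneous element of [P] is [a z^j]. If [z] is in [P], so is some [h i], and [P] is
    a branch. Otherwise [a] is in [P], and so is an irreducible homogeneous [p]; it cannot divide
    [g = z ^+ n], so it generates a nonzero prime inside [P], which is [P] by height one. *)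
Lemma prime_divisorP (P : prime_divisor R) :
  [\/ homogeneous_free phi P, exists i, P = branch_divisor i
    | exists p : A, [/\ irreducible_element p, homogeneous phiA p, n = 1%N \/ ~ divides p g
                  & ideal_of P = principal_ideal p]].
Proof.
have prP := prime_divisor_prime P.
have [nhP|/existsNP[y /not_implyP[y0 /not_implyP[hy /contrapT Py]]]] :=
  pselect (homogeneous_free phi P); first by constructor 1.
have [Pz|nPz] := pselect (ideal_of P z); first by constructor 2; apply: prime_divisor_z.
constructor 3; have [a [j [_ ha yE]]] := phi_hom hy.
have Pa : ideal_of P 'i a by move: Py; rewrite yE => /(primeM prP)[//|/(primeX prP)].
have a0 : a != 0 by apply: contraNneq y0 => a0; rewrite yE a0 rmorph0 mul0r.
have [[mu muP] _] := fA.
have [|||| p [Pp hp] p_irr] := @minimal_length_irreducible _ mu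
    (fun b => ideal_of P 'i b /\ homogeneous phiA b) a muP => //.
- move=> b [Pb _]; apply/negP => Ub; apply: (prime1 prP).
  by rewrite -(rmorph1 pi) -polyC1 -(mulVr Ub) polyCM rmorphM; apply: primeMl.
- move=> b c [Pbc hbc] bc0; have [hb hc] := homogeneous_factor phiAP bc0 hbc.
  by move: Pbc; rewrite polyCM rmorphM => /(primeM prP)[]; [left|right].
have npg : ~ divides p g.
  move=> [w gE]; apply: nPz; apply: (@primeX _ _ prP _ n).
  by rewrite pi_zn // gE polyCM rmorphM; apply: primeMl.
have cond : n = 1%N \/ ~ divides p g by right.
exists p; split => //; symmetry; apply: prime_divisor_sub.
- exact: principal_ideal_prime.
- by exists ('i p); [exact: dividesxx|rewrite piC_eq0 //; case: p_irr].
- by move=> _ [w ->]; apply: primeMl.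
Qed.

Lemma prime_divisor_uniformizer (P : prime_divisor R) : exists t, uniformizer P t.
Proof.
case: (prime_divisorP P) => [nhP|[i ->]|[p [p_irr hp npg ->]]].
- have [f [Pf _ _]] := homogeneous_free_uniformizer phiP (prime_divisor_prime P)
    (prime_divisor_nonzero P) nhP.
  by exists f.
- by have [t []] := branch_uniformizer_ex i; exists t.
- by exists ('i p); apply: principal_ideal_uniformizer.
Qed.

(** * Generators and relations of the class group *)

Local Notation unif := prime_divisor_uniformizer.
Local Notation "x %:F" := (@tofrac R x).

Definition branch_class i : class_group R := divisor_class <<branch_divisor i>>.

Lemma branch_class_ideal i : ideal_class (ideal2 z 'i (h i)) = branch_class i.
Proof. by rewrite /ideal_class (ideal_div_prime unif (branch_divisor i)). Qed.

Lemma branch_class_torsion i : branch_class i *+ n = 0.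
Proof.
rewrite /branch_class -raddfMn; have h0 : 'i (h i) != 0 by rewrite piC_eq0 h_neq0.
apply: (is_div_class h0) => Q; rewrite coeffMn coeff_prime.
have [<-|neq_Q] := eqVneq (branch_divisor i) Q.
  have [t [Pt ht]] := branch_uniformizer_ex i.
  rewrite (val_at_order (P := branch_divisor i) Pt ht); exact: natz.
rewrite mul0rn; symmetry; apply/(val_at_eq0 unif) => // /prime_divisor_h Qi.
by rewrite Qi eqxx in neq_Q.
Qed.

Lemma branch_divisor_inj : (1 < n)%N -> injective branch_divisor.
Proof.
move=> n_gt1 i j ij; apply: contrapT => /eqP neq_ij.
have : branch_ideal j 'i (h i).
  have <- : branch_ideal i = branch_ideal j by rewrite -[LHS]/(ideal_of (branch_divisor i)) ij.
  exact/branch_idealC/dividesxx.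
move/branch_idealC => ji; case: (cofactor_coprime (i := j) n_gt1).
by rewrite (bigD1 i) //=; apply: dividesMr.
Qed.

Lemma val_branch_z i : (1 < n)%N -> val_at (branch_divisor i) z%:F = 1.
Proof.
move=> n_gt1; rewrite (val_at_order (P := branch_divisor i) (branch_uniformizer i n_gt1) (m :=
    1)) //.
by rewrite -{2}[z]expr1; apply/has_order_exp/branch_ideal_prime.
Qed.

Lemma branch_class_sum : (1 < n)%N -> \sum_i branch_class i = 0.
Proof.
move=> n_gt1; rewrite /branch_class -raddf_sum.
apply: (is_div_class z_neq0) => Q; rewrite raddf_sum /=.
have [Qz|nQz] := pselect (ideal_of Q z); last first.
  rewrite big1 => [|i _]; first by symmetry; apply/(val_at_eq0 unif) => //; apply: z_neq0.
  rewrite coeff_prime; case: eqP => // iQ; case: nQz; rewrite -iQ; exact: branch_ideal_z.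
have [i ->] := prime_divisor_z Qz; rewrite val_branch_z // (bigD1 i) //= coeff_prime eqxx.
by rewrite big1 ?addr0 // => j neq_ji;
  rewrite coeff_prime (inj_eq (branch_divisor_inj n_gt1)) (negbTE neq_ji).
Qed.

Implicit Types c : class_group R.

Definition spanned c := exists a : 'I_r.+1 -> int, c = \sum_i branch_class i *~ a i.

Lemma spanned0 : spanned 0.
Proof. by exists (fun=> 0); rewrite big1 // => i _; rewrite mulr0z. Qed.

Lemma spannedB c c' : spanned c -> spanned c' -> spanned (c - c').
Proof.
move=> [a ->] [b ->]; exists (fun i => a i - b i); rewrite -sumrB.
by apply: eq_bigr => i _; rewrite mulrzBr.
Qed.

Lemma spannedD c c' : spanned c -> spanned c' -> spanned (c + c').
Proof.
by move=> sc sc'; rewrite -[c']opprK -[- c']sub0r; do 2!apply: spannedB => //; apply: spanned0.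
Qed.

Lemma spanned_mulz c m : spanned c -> spanned (c *~ m).
Proof.
move=> [a ->]; exists (fun i => a i * m); rewrite mulrz_suml.
by apply: eq_bigr => i _; rewrite mulrzA.
Qed.

Lemma spanned_branch i : spanned (branch_class i).
Proof.
exists (fun j => (j == i)%:Z); rewrite (bigD1 i) //= eqxx mulr1z big1 ?addr0 // => j.
by move=> /negbTE ->; rewrite mulr0z.
Qed.

Lemma spanned_sum I (s : seq I) (F : I -> class_group R) :
  (forall j, spanned (F j)) -> spanned (\sum_(j <- s) F j).
Proof. by move=> FP; elim/big_rec: _ => [|j x _]; [exact: spanned0|apply: spannedD]. Qed.

(* The generator of [P] in the homogeneous localization can be chosen without
   homogeneous prime factors; its divisor is then [P] plus branches. *)
Lemma homogeneous_free_spanned (P : prime_divisor R) : homogeneous_free phi P ->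
  spanned (divisor_class <<P>>).
Proof.
move=> nhP; have prP := prime_divisor_prime P.
have [f [Pf nhf fP]] := homogeneous_free_uniformizer phiP prP (prime_divisor_nonzero P) nhP.
have [_ _ f0 ord_ex] := Pf.
(* Removing a homogeneous prime of [A] from a divisor of [f] keeps its order at [P] and lowers its
   top degree, so the smallest such [f1] has no factor of this kind. *)
have [|f1 [[w fE] f1_ord] min_f1] := @ex_minimizer _
    (fun f1 => divides f1 f /\ has_order P f f1 1) (fun y => size (phi y)).
  by exists f; split; [exact: dividesxx|rewrite -{2}[f]expr1; apply: has_order_exp].
have f10 : f1 != 0 by apply: contraNneq f0 => f10; rewrite fE f10 mulr0.
(* [f1] divides [f], which generates [P] up to homogeneous factors; these avoid [Q], so [Q] contains
   [P]. *)
have free_f1 (Q : prime_divisor R) : homogeneous_free phi Q -> ideal_of Q f1 -> Q = P.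
  move=> nhQ Qf1; have prQ := prime_divisor_prime Q; symmetry;
    apply: prime_divisor_subP => y Py.
  have [s [s0 hs [u yE]]] := fP y Py.
  have /(primeM prQ)[/nhQ|//] : ideal_of Q (s * y).
    by rewrite yE fE mulrA; apply: primeMl.
  by move/(_ s0 hs).
have principal_f1 (p : A) : irreducible_element p -> homogeneous phiA p -> ~ divides 'i p f1.
  move=> p_irr [i hp] [w1 f1E]; have [p0 pU _] := p_irr.
  have ip0 : 'i p != 0 by rewrite piC_eq0.
  have w10 : w1 != 0 by apply: contraNneq f10 => w10; rewrite f1E w10 mul0r.
  have nPp : ~ ideal_of P 'i p by apply: nhP => //; exists (n * i)%N; apply: phiC.
  have i_gt0 : (0 < i)%N.
    by rewrite lt0n; apply/eqP => i0; case/negP: pU; apply: degree0_unit; rewrite // {1}hp i0.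
  have [m w1m] := ord_ex _ w10.
  have : m = 1%N.
    have := has_orderM prP w1m (has_order_notin f prP nPp).
    by rewrite -f1E addn0 => /(has_order_inj Pf)/(_ f1_ord).
  move=> m1; rewrite m1 in w1m.
  have /negP : ~~ (size (phi f1) <= size (phi w1))%N.
    rewrite -ltnNge f1E rmorphM (phiC hp) -scalerAr size_scale // size_mulXn ?cograding_eq0 //.
    by rewrite -[X in (X < _)%N]add0n ltn_add2r muln_gt0 n_gt0.
  by apply; apply: min_f1; split=> //; exists (w * 'i p); rewrite fE f1E; ring.
(* For [n = 1] repeated factors of [g] give equal branches; each must be counted once. *)
pose s := undup (codom branch_divisor).
pose D : weil_divisor R := <<P>> + \sum_(Q <- s) <<Q>> *~ val_at Q f1%:F.
have P_branch : P \notin s.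
  rewrite mem_undup; apply/codomP => -[i PE].
  have h0 : h i != 0 by apply: h_neq0.
  apply: (nhP 'i (h i)); rewrite ?piC_eq0 //.
    by have [j hE] := h_homogeneous i; exists (n * j)%N; apply: phiC.
  by rewrite PE; apply/branch_idealC/dividesxx.
have coeffD Q : coeff Q D = (P == Q)%:R + (Q \in s)%:R * val_at Q f1%:F.
  rewrite /D raddfD /= coeff_prime; congr (_ + _); rewrite raddf_sum /=.
  rewrite (eq_bigr (fun Q' => (Q' == Q)%:R * val_at Q f1%:F)).
    rewrite -mulr_suml; congr (_ * _).
    have [Qs|nQs] := boolP (Q \in s).
      rewrite (bigD1_seq Q) ?undup_uniq //= eqxx big1 ?addr0 // => Q' /negbTE -> //.
    rewrite big_seq big1 // => Q' Q's; case: eqP => // Q'Q; by rewrite -Q'Q Q's in nQs.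
  move=> Q' _; rewrite raddfMz /= coeff_prime; case: eqP => [->|_];
    last by rewrite mul0rz mul0r.
  by rewrite mul1r intz.
have : divisor_class D = 0.
  apply: (is_div_class f10) => Q; rewrite coeffD.
  have [<-|neq_PQ] := eqVneq P Q.
    by rewrite (negbTE P_branch) mul0r addr0 (val_at_order Pf f1_ord).
  have [Qs|nQs] := boolP (Q \in s); first by rewrite add0r mul1r.
  rewrite add0r mul0r; symmetry; apply/(val_at_eq0 unif) => // Qf1.
  case: (prime_divisorP Q) => [nhQ|[i QE]|[p [p_irr hp npg QE]]].
  - by rewrite (free_f1 Q nhQ Qf1) eqxx in neq_PQ.
  - by move: nQs; rewrite QE mem_undup codom_f.
  - by move: Qf1; rewrite QE; apply: principal_f1.
rewrite raddfD raddf_sum /= => /eqP; rewrite addr_eq0 => /eqP ->; rewrite -sub0r.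
apply: spannedB; first exact: spanned0.
rewrite big_seq; elim/big_rec: _ => [|Q x]; first exact: spanned0.
rewrite mem_undup => /codomP[i ->] sx; apply: spannedD => //.
by rewrite raddfMz; apply/spanned_mulz/spanned_branch.
Qed.

Lemma prime_divisor_spanned (P : prime_divisor R) : spanned (divisor_class <<P>>).
Proof.
case: (prime_divisorP P) => [|[i ->]|[p [p_irr hp npg PE]]].
- exact: homogeneous_free_spanned.
- exact: spanned_branch.
have ip0 : 'i p != 0 by rewrite piC_eq0; case: p_irr.
rewrite (is_div_class ip0) => [|Q]; first exact: spanned0.
rewrite coeff_prime; have [<-|neq_PQ] := eqVneq P Q.
  have Pp := principal_ideal_uniformizer p_irr hp npg; rewrite -PE in Pp.
  rewrite (val_at_order Pp (m := 1)) // -{2}['i p]expr1; apply: has_order_exp.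
  exact: prime_divisor_prime.
symmetry; apply/(val_at_eq0 unif) => // Qp; case/eqP: neq_PQ; apply: prime_divisor_subP.
by rewrite PE => _ [w ->]; apply: primeMl => //; apply: prime_divisor_prime.
Qed.

Lemma class_group_spanned c : spanned c.
Proof.
have [D <-] := divisor_class_surj c; rewrite (weil_divisor_sum D) raddf_sum /=.
by apply: spanned_sum => P; rewrite raddfMz; apply/spanned_mulz/prime_divisor_spanned.
Qed.

(** A nonzero homogeneous element [b z^j] has value [j] modulo [n] at every P_i, with the same [j]
    for all i. Hence the values of a quotient of two such elements agree modulo [n]. *)
Lemma branch_class_relation (a : 'I_r.+1 -> int) : (1 < n)%N ->
  \sum_i branch_class i *~ a i = 0 -> exists m : int, forall i, (n %| a i - m)%Z.
Proof.
move=> n_gt1.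
have -> : \sum_i branch_class i *~ a i = divisor_class (\sum_i <<branch_divisor i>> *~ a i).
  by rewrite raddf_sum; apply: eq_bigr => i _; rewrite raddfMz.
move=> /divisor_class_eq0[x x0 xD].
have valx i : val_at (branch_divisor i) x = a i.
  rewrite -xD raddf_sum /= (bigD1 i) //= raddfMz /= coeff_prime eqxx intz big1 ?addr0 // => j.
  rewrite raddfMz /= coeff_prime (inj_eq (branch_divisor_inj n_gt1)) => /negbTE ->.
  exact: mul0rz.
have [|s [t [s0 hs t0 ht xE]]] := fraction_homogeneous phiP x0.
  move=> P nhP; rewrite -xD raddf_sum /= big1 // => i _; rewrite raddfMz /= coeff_prime.
  case: eqP => [iP|_]; last exact: mul0rz.
  case: (nhP 'i (h i)); rewrite ?piC_eq0 ?h_neq0 //.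
    by have [j hE] := h_homogeneous i; exists (n * j)%N; apply: phiC.
  by rewrite -iP; apply/branch_idealC/dividesxx.
have val_hom y : y != 0 -> homogeneous phi y ->
    exists j : nat, forall i, exists m :
        nat, val_at (branch_divisor i) y%:F = (n * m + j)%N%:Z.
  move=> y0 /phi_hom[b [j [_ _ yE]]]; exists j => i.
  have b0 : b != 0 by apply: contraNneq y0 => b0; rewrite yE b0 rmorph0 mul0r.
  have [m bm] := branch_orderC i n_gt1 b0; exists m.
  apply: (val_at_order (P := branch_divisor i) (branch_uniformizer i n_gt1)).
  rewrite yE; apply: has_orderM => //; first exact: branch_ideal_prime.
  by apply: has_order_exp; exact: branch_ideal_prime.
have [j sj] := val_hom _ s0 hs; have [j' tj'] := val_hom _ t0 ht.
exists (j%:Z - j'%:Z) => i; have [m sm] := sj i; have [m' tm'] := tj' i.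
have -> : a i = (n * m + j)%N%:Z - (n * m' + j')%N%:Z.
  by rewrite -valx xE val_at_div ?tofrac_eq0 // sm tm'.
apply/dvdzP; exists (m%:Z - m'%:Z); rewrite !PoszD !PoszM; ring.
Qed.

Lemma hypersurface_class_group :
  let c (i : 'I_r) := ideal_class (ideal2 z 'i (h (widen_ord (leqnSn r) i))) in
  [/\ isomorphic_groups (class_group R) {ffun 'I_r -> integers_mod n},
      generates c [set: 'I_r]%SET & (1 < n)%N -> minimally_generates c].
Proof.
move=> c; have -> : c = fun i => branch_class (widen_ord (leqnSn r) i).
  by apply: funext => i; apply: branch_class_ideal.
split=> [||n_gt1].
- exact: (cyclic_sum_iso n_gt0 class_group_spanned branch_class_torsion branch_class_sum
    branch_class_relation).
- exact: (cyclic_sum_generates n_gt0 class_group_spanned branch_class_torsion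
    branch_class_sum).
- exact: (cyclic_sum_minimally_generates n_gt0 class_group_spanned branch_class_torsion
    branch_class_sum
    branch_class_relation n_gt1).
Qed.

End Hypersurface.

(** * The theorem for polynomial rings over a field *)

Unset Implicit Arguments.

Theorem proposition3p1 (k : fieldType) (d n : nat) (n_gt0 : (0 < n)%N)
    (g : {mpoly k[d]}) (e : nat)
    (g_hom : weighted_homogeneous g e) (e_n : coprime e n)
    (R : idomainType) (pi : {rmorphism {poly {mpoly k[d]}} -> R})
    (R_pres : presents_hypersurface n g pi) (R_normal : integrally_closed R)
    (r : nat) (r_gt0 : (0 < r)%N) (h : 'I_r -> {mpoly k[d]})
    (h_irr : forall i, irreducible_element (h i))
    (g_fact : g = \prod_(i < r) h i) :
  let z : R := pi 'X in
  let c : 'I_r.-1 -> class_group R := fun i =>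
    ideal_class (ideal2 z (pi (h (widen_ord (leq_pred r) i))%:P)) in
  [/\ isomorphic_groups (class_group R) {ffun 'I_r.-1 -> integers_mod n},
      generates c [set: 'I_r.-1]%SET
    & (1 < n)%N -> minimally_generates c].
Proof.
have [G [grG G0E Ge]] := g_hom; have [pi_surj pi_ker] := R_pres.
have G1 : G 0%N 1 by apply/G0E; exists 1; rewrite mpolyC1.
have [phiA [phiAP phiG phiAG]] := cograding_ex grG G1.
have g_e : phiA g = g *: 'X^e by apply: phiG.
have [phi [phiP phiC phi_hom]] := hypersurface_cograding n_gt0 e_n pi_surj pi_ker phiAP g_e.
have A0_unit a : a != 0 -> phiA a = a *: 'X^0 -> a \is a GRing.unit.
  move=> a0 /phiAG/G0E[c aE]; move: a0; rewrite aE mpolyC_eq0 => c0.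
  by apply: (rmorph_unit (@mpolyC d k)); rewrite unitfE.
case: r r_gt0 h h_irr g_fact => // m _ h h_irr g_fact.
(* The two inclusions of index sets differ only in their proofs of [m <= m.+1]. *)
rewrite (bool_irrelevance (leq_pred m.+1) (leqnSn m)).
have H := hypersurface_class_group n_gt0 e_n pi_surj pi_ker phiAP g_e phiP phiC phi_hom
  (@factorial_mpoly k d) A0_unit h_irr g_fact R_normal.
move=> z c; exact: H.
Qed.
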